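(* Let $U\in\mathrm{SpSt}(2n,2k)$ and $\Delta\in T_U\mathrm{SpSt}(2n,2k)$. Define $A=U^+\Delta$ and $H=\Delta-UA$. If $H^+H$ is invertible, then the geodesic (with respect to the pseudo-Riemannian metric $h^{\mathrm{SpSt}}$) from $U$ in direction $\Delta$ is given by $$\mathrm{Exp}^{\mathrm{SpSt},h}_U(t\Delta)=\begin{bmatrix}U&\frac12UA+H\end{bmatrix}\exp\left(t\begin{bmatrix}\frac12A&\frac14A^2-H^+H\\ I_{2k}&\frac12A\end{bmatrix}\right)\begin{bmatrix}I_{2k}\\ 0\end{bmatrix}.$$
   Context: Let $k\le n$ be positive integers, $J_{2m}=\begin{bmatrix}0&I_m\\ -I_m&0\end{bmatrix}$, and for a real $2a\times 2b$ matrix $A$ put $A^+:=J_{2b}^TA^TJ_{2a}$ (symplectic inverse). $\mathfrak{sp}(2k,\mathbb{R})=\{\Omega\in\mathbb{R}^{2k\times2k}:\Omega^+=-\Omega\}$. $\mathrm{SpSt}(2n,2k)=\{U\in\mathbb{R}^{2n\times2k}:U^+U=I_{2k}\}$ is the real symplectic Stiefel manifold, with tangent spaces $T_U\mathrm{SpSt}(2n,2k)=\{\Delta\in\mathbb{R}^{2n\times2k}: U^+\Delta\in\mathfrak{sp}(2k,\mathbb{R})\}$. It carries the pseudo-Riemannian metric $h^{\mathrm{SpSt}}_U(\Delta_1,\Delta_2)=\mathrm{tr}\left(\Delta_1^+\left(I_{2n}-\frac12UU^+\right)\Delta_2\right)$; $t\mapsto\mathrm{Exp}^{\mathrm{SpSt},h}_U(t\Delta)$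 denotes its geodesic starting at $U$ with initial velocity $\Delta$, and $\exp$ is the matrix exponential. *)

(* Defs.v *)
From HB Require Import structures.
From mathcomp Require Import all_boot all_order all_algebra.
From mathcomp Require Import all_classical all_reals all_analysis.

Set Implicit Arguments.
Unset Strict Implicit.
Unset Printing Implicit Defensive.

Import Order.TTheory GRing.Theory Num.Theory.
Import numFieldNormedType.Exports.

Local Open Scope ring_scope.
Local Open Scope classical_set_scope.

(* [f] is C^oo on [D], which is meant to be open: all the iterated directional
   derivatives of [f] are differentiable at every point of [D]. *)
Definition smooth_on (R : realType) (V W : normedModType R) (D : set V)
    (f : V -> W) : Prop :=
  forall (vs : seq V) (x : V), D x ->
    differentiable (foldr (fun v g => 'D_v g) f vs) x.

(* Geodesics of a pseudo-Riemannian metric [g] on a closed embedded submanifold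
   [M], with tangent spaces [T], of a normed space [V]; they are the curves
   whose velocity is parallel for the Levi-Civita connection.  Since [M] is
   closed, the smooth functions and vector fields on [M] are the restrictions
   of those on [V].  They are represented by such extensions, and all the
   identities below are only required on [M]. *)

Definition vector_field (R : realType) (V : normedModType R) (M : set V)
    (T : V -> set V) (X : V -> V) : Prop :=
  smooth_on setT X /\ (forall p, M p -> T p (X p)).

Record levi_civita (R : realType) (V : normedModType R) (M : set V)
    (T : V -> set V) (g : V -> V -> V -> R)
    (nabla : (V -> V) -> (V -> V) -> V -> V) : Prop := LeviCivita {
  lc_field : forall X Y, vector_field M T X -> vector_field M T Y ->
    vector_field M T (nabla X Y);
  lc_addl : forall X1 X2 Y, vector_field M T X1 -> vector_field M T X2 ->
    vector_field M T Y -> forall p, M p ->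
    nabla (X1 \+ X2) Y p = nabla X1 Y p + nabla X2 Y p;
  lc_scalel : forall (f : V -> R) X Y, smooth_on setT f ->
    vector_field M T X -> vector_field M T Y -> forall p, M p ->
    nabla (fun q => f q *: X q) Y p = f p *: nabla X Y p;
  lc_addr : forall X Y1 Y2, vector_field M T X -> vector_field M T Y1 ->
    vector_field M T Y2 -> forall p, M p ->
    nabla X (Y1 \+ Y2) p = nabla X Y1 p + nabla X Y2 p;
  lc_leibniz : forall (f : V -> R) X Y, smooth_on setT f ->
    vector_field M T X -> vector_field M T Y -> forall p, M p ->
    nabla X (fun q => f q *: Y q) p =
      'D_(X p) f p *: Y p + f p *: nabla X Y p;
  (* the right-hand side is the Lie bracket [X, Y] *)
  lc_torsion_free : forall X Y, vector_field M T X -> vector_field M T Y ->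
    forall p, M p ->
    nabla X Y p - nabla Y X p = 'D_(X p) Y p - 'D_(Y p) X p;
  lc_metric : forall X Y Z, vector_field M T X -> vector_field M T Y ->
    vector_field M T Z -> forall p, M p ->
    'D_(X p) (fun q => g q (Y q) (Z q)) p =
      g p (nabla X Y p) (Z p) + g p (Y p) (nabla X Z p) }.

Definition field_along (R : realType) (V : normedModType R)
    (T : V -> set V) (I : set R) (c : R -> V) (Z : R -> V) : Prop :=
  smooth_on I Z /\ (forall t, I t -> T (c t) (Z t)).

(* [D] is the covariant derivative along [c] induced by [nabla].  In
   [cd_induced], [X] is any extension of the velocity of [c] at time [t]: by
   tensoriality, [nabla X Y (c t)] only depends on [X (c t)]. *)
Record covariant_derivative_along (R : realType) (V : normedModType R)
    (M : set V) (T : V -> set V) (nabla : (V -> V) -> (V -> V) -> V -> V)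
    (I : set R) (c : R -> V) (D : (R -> V) -> R -> V) : Prop :=
  CovariantDerivativeAlong {
  cd_field : forall Z, field_along T I c Z -> field_along T I c (D Z);
  cd_add : forall Z1 Z2, field_along T I c Z1 -> field_along T I c Z2 ->
    forall t, I t -> D (Z1 \+ Z2) t = D Z1 t + D Z2 t;
  cd_leibniz : forall (f : R -> R) Z, smooth_on I f -> field_along T I c Z ->
    forall t, I t ->
    D (fun s => f s *: Z s) t = derive1 f t *: Z t + f t *: D Z t;
  cd_induced : forall X Y, vector_field M T X -> vector_field M T Y ->
    forall t, I t -> X (c t) = c^`() t -> D (Y \o c) t = nabla X Y (c t) }.

Definition geodesic (R : realType) (V : normedModType R) (M : set V)
    (T : V -> set V) (g : V -> V -> V -> R) (I : set R) (c : R -> V) : Prop :=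
  [/\ open I, is_interval I, smooth_on I c, (forall t, I t -> M (c t)) &
      exists nabla D,
        [/\ levi_civita M T g nabla,
            covariant_derivative_along M T nabla I c D &
            forall t, I t -> D (c^`()) t = 0] ].

(* [riem_exp M T g p v] is the value at time 1 of the geodesic starting at [p]
   with initial velocity [v]; it is meaningful when that geodesic is defined
   up to time 1. *)
Definition riem_exp (R : realType) (V : normedModType R) (M : set V)
    (T : V -> set V) (g : V -> V -> V -> R) (p v : V) : V :=
  get [set q | exists (I : set R) (c : R -> V),
    [/\ geodesic M T g I c, I 0, I 1 & [/\ c 0 = p, c^`() 0 = v & c 1 = q]] ].

Definition expm (R : realType) (m : nat) (A : 'M[R]_m) : 'M[R]_m :=
  limn (series (fun i : nat => (i`!%:R)^-1 *: A ^+ i)).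

Definition Jmx (R : realType) (m : nat) : 'M[R]_(m + m) :=
  block_mx 0 1%:M (- 1%:M) 0.

Definition sympinv (R : realType) (a b : nat) (A : 'M[R]_(a + a, b + b)) :
    'M[R]_(b + b, a + a) :=
  (Jmx R b)^T *m A^T *m Jmx R a.

Notation "A ^[+]" := (sympinv A) (at level 2, format "A ^[+]") : ring_scope.

Definition sp (R : realType) (k : nat) : set 'M[R]_(k + k) :=
  [set Omega | Omega^[+] = - Omega].

Definition SpSt (R : realType) (n k : nat) : set 'M[R]_(n + n, k + k) :=
  [set U | U^[+] *m U = 1%:M].

Definition TSpSt (R : realType) (n k : nat) (U : 'M[R]_(n + n, k + k)) :
    set 'M[R]_(n + n, k + k) :=
  [set Delta | sp (U^[+] *m Delta)].

Definition hSpSt (R : realType) (n k : nat)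
    (U Delta1 Delta2 : 'M[R]_(n + n, k + k)) : R :=
  \tr (Delta1^[+] *m (1%:M - 2^-1 *: (U *m U^[+])) *m Delta2).

Definition ExpSpSt (R : realType) (n k : nat) :
    'M[R]_(n + n, k + k) -> 'M[R]_(n + n, k + k) -> 'M[R]_(n + n, k + k) :=
  riem_exp (@SpSt R n k) (@TSpSt R n k) (@hSpSt R n k).

(* Main.v *)
Require Import Defs.
From HB Require Import structures.
From mathcomp Require Import all_boot all_order all_algebra.
From mathcomp Require Import all_classical all_reals all_analysis.
From mathcomp Require Import ring lra.

Set Implicit Arguments.
Unset Strict Implicit.
Unset Printing Implicit Defensive.

Import Order.TTheory GRing.Theory Num.Theory.
Import numFieldNormedType.Exports.

Local Open Scope ring_scope.
Local Open Scope classical_set_scope.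

(** Write [A^+] for the symplectic inverse of [A]. For [p] in SpSt and a tangent
    vector [X] at [p], the matrix [W = X p^+ - p X^+ - p p^+ X p^+] ([momentum])
    is Hamiltonian, [W^+ = - W], and satisfies [W p = X]. It is the horizontal
    lift of [X] to the Lie algebra of the symplectic group, of which SpSt is a
    homogeneous space, and it is equivariant under that group. The metric comes
    from an invariant trace form, so the geodesic with velocity [X] at [p] has
    to be the orbit [t |-> expm (t W) p].

    That the orbits are geodesics follows from an explicit connection. Its
    Christoffel form, [- (W(X) Y + W(Y) X) / 2] ([christoffel]), is polynomial
    in the base point, hence extends smoothly to all matrices. It is symmetric;
    it maps tangent fields to tangent fields because of the second derivative
    of the equation [p^+ p = 1] ([christoffel_tangency] and
    [derive_tangent_field]); it is compatible with the metric because of the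
    invariance of the trace under cyclic permutations and under [A |-> A^+]
    ([christoffel_metric]). By equivariance [W] is constant along the orbit [c],
    so that [c'' = W c'], which is the geodesic equation ([geodesic_orbit]).

    The value of the exponential map also requires that no other geodesic
    starts with the same velocity, whichever connection and covariant
    derivative it is attached to. The metric is nondegenerate on the tangent
    spaces ([hSpSt_nondegenerate]), so the connection is determined on SpSt
    ([levi_civita_SpSt_unique]). The projections onto the tangent spaces of the
    matrix units are global fields that span every tangent space, so the
    covariant derivative along a curve is determined too
    ([covariant_derivative_formula]). A geodesic [c] thus satisfies
    [c'' = W(c') c']. This implies that its momentum [W(c')] is conserved
    ([momentum_conserved]), and what is left is the linear equation
    [c' = W c] with a constant [W], whose only solution is [expm (t W) c(0)]
    ([geodesic_eq_orbit]).

    Finally, [W] acts on the span of the columns of [U] and [U A / 2 + H] by the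
    block matrix of the theorem ([momentum_block]), so the closed formula solves
    the same linear equation as the orbit. *)

(** * Derivatives of matrix-valued functions *)

Section MatrixDerivative.
Context {R : realType} {V : normedModType R}.
Implicit Types (x v : V).

Lemma is_derive_mxP m n (f : V -> 'M[R]_(m, n)) x v (df : 'M[R]_(m, n)) :
  is_derive x v f df <->
  forall i j, is_derive x v (fun y => f y i j) (df i j).
Proof.
split=> [[fx <-] i j|fx].
  split; first by move/derivable_mxP: fx.
  by rewrite derive_mx // mxE.
have dfx : derivable f x v by apply/derivable_mxP => i j; case: (fx i j).
split=> //; rewrite derive_mx //; apply/matrixP => i j; rewrite mxE.
by case: (fx i j).
Qed.

Lemma is_derive_big (W : normedModType R) (I : Type) (r : seq I)
    (f : I -> V -> W) (df : I -> W) x v : (forall i, is_derive x v (f i) (df i)) ->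
  is_derive x v (fun y => \sum_(i <- r) f i y) (\sum_(i <- r) df i).
Proof.
move=> fx; elim: r => [|i r IHr].
  rewrite big_nil (_ : (fun _ => _) = cst 0); first exact: is_derive_cst.
  by apply/funext => y; rewrite big_nil.
rewrite big_cons (_ : (fun _ => _) = f i + (fun y => \sum_(j <- r) f j y)).
  exact: is_deriveD.
by apply/funext => y; rewrite big_cons.
Qed.

Lemma is_derive_mulmx m n p (f : V -> 'M[R]_(m, n)) (g : V -> 'M[R]_(n, p))
    x v df dg : is_derive x v f df -> is_derive x v g dg ->
  is_derive x v (fun y => f y *m g y) (df *m g x + f x *m dg).
Proof.
move=> /is_derive_mxP fx /is_derive_mxP gx; apply/is_derive_mxP => i k.
under eq_fun do rewrite mxE.
rewrite !mxE -big_split /=; apply: is_derive_big => j.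
apply: is_derive_eq (is_deriveM (fx i j) (gx j k)) _.
by rewrite /GRing.scale /=; ring.
Qed.

Lemma is_derive_mulmxl m n p (A : 'M[R]_(m, n)) (g : V -> 'M[R]_(n, p))
    x v dg : is_derive x v g dg ->
  is_derive x v (fun y => A *m g y) (A *m dg).
Proof.
move=> gx; apply: is_derive_eq (is_derive_mulmx (is_derive_cst A x v) gx) _.
by rewrite mul0mx add0r.
Qed.

Lemma is_derive_mulmxr m n p (A : 'M[R]_(n, p)) (f : V -> 'M[R]_(m, n))
    x v df : is_derive x v f df ->
  is_derive x v (fun y => f y *m A) (df *m A).
Proof.
move=> fx; apply: is_derive_eq (is_derive_mulmx fx (is_derive_cst A x v)) _.
by rewrite mulmx0 addr0.
Qed.

Lemma is_derive_trmx m n (f : V -> 'M[R]_(m, n)) x v df :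
  is_derive x v f df -> is_derive x v (fun y => (f y)^T) df^T.
Proof.
move=> /is_derive_mxP fx; apply/is_derive_mxP => i j.
by under eq_fun do rewrite mxE; rewrite mxE.
Qed.

Lemma is_derive_mxtrace m (f : V -> 'M[R]_m) x v df :
  is_derive x v f df -> is_derive x v (fun y => \tr (f y)) (\tr df).
Proof.
by move=> /is_derive_mxP fx; apply: is_derive_big => i.
Qed.

Lemma is_derive_scalemx m n (a : V -> R) (f : V -> 'M[R]_(m, n)) x v da df :
  is_derive x v a da -> is_derive x v f df ->
  is_derive x v (fun y => a y *: f y) (da *: f x + a x *: df).
Proof.
move=> ax /is_derive_mxP fx; apply/is_derive_mxP => i j.
under eq_fun do rewrite mxE.
rewrite !mxE; apply: is_derive_eq (is_deriveM ax (fx i j)) _.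
by rewrite /GRing.scale /=; ring.
Qed.

Lemma differentiable_big (W : normedModType R) (I : Type) (r : seq I)
    (f : I -> V -> W) x : (forall i, differentiable (f i) x) ->
  differentiable (fun y => \sum_(i <- r) f i y) x.
Proof.
move=> fx; elim: r => [|i r IHr].
  rewrite (_ : (fun _ => _) = cst 0); first exact: differentiable_cst.
  by apply/funext => y; rewrite big_nil.
rewrite (_ : (fun _ => _) = f i + (fun y => \sum_(j <- r) f j y)).
  exact: differentiableD.
by apply/funext => y; rewrite big_cons.
Qed.

Lemma differentiable_mxP m n (f : V -> 'M[R]_(m, n)) x :
  differentiable f x <-> forall i j, differentiable (fun y => f y i j) x.
Proof.
split=> [fx i j|fx].
  apply: (@differentiable_comp _ _ _ _ f (fun N : 'M[R]_(m, n) => N i j)) => //.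
  exact: differentiable_coord.
rewrite (_ : f = fun y => \sum_i \sum_j f y i j *: delta_mx i j).
  apply: differentiable_big => i; apply: differentiable_big => j.
  exact: differentiableZl.
by apply/funext => y; exact: matrix_sum_delta.
Qed.

End MatrixDerivative.

(** * Smooth functions *)

Section Smooth.
Context {R : realType} {V : normedModType R}.
Implicit Types (D : set V) (W : normedModType R).

(** Closure properties of smooth functions are proved by induction on the number
    of derivatives: a derivative of a product is a sum of products. *)
Definition smooth_upto W (n : nat) D (f : V -> W) : Prop :=
  forall vs : seq V, (size vs <= n)%N -> forall x, D x ->
  differentiable (foldr (fun v g => 'D_v g) f vs) x.

Lemma smooth_onP W D (f : V -> W) :
  smooth_on D f <-> forall n, smooth_upto n D f.
Proof.
by split=> [fD n vs _ x|fD vs x]; [exact: fD|exact: (fD (size vs))].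
Qed.

Lemma smooth_upto_differentiable W n D (f : V -> W) x :
  D x -> smooth_upto n D f -> differentiable f x.
Proof. by move=> Dx fD; apply: (fD [::]). Qed.

Lemma smooth_on_differentiable W D (f : V -> W) x :
  D x -> smooth_on D f -> differentiable f x.
Proof. by move=> Dx fD; apply: (fD [::]). Qed.

Lemma smooth_uptoW W n D (f : V -> W) :
  smooth_upto n.+1 D f -> smooth_upto n D f.
Proof. by move=> fD vs vsn; apply: fD; rewrite ltnW. Qed.

Lemma smooth_upto_derive W n D (f : V -> W) v :
  smooth_upto n.+1 D f -> smooth_upto n D ('D_v f).
Proof.
by move=> fD vs vsn x Dx; have := fD (rcons vs v); rewrite size_rcons foldr_rcons;
   apply.
Qed.

Lemma smooth_uptoS W n D (f : V -> W) :
  (forall x, D x -> differentiable f x) ->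
  (forall v, smooth_upto n D ('D_v f)) -> smooth_upto n.+1 D f.
Proof.
move=> f1 fn vs; elim/last_ind: vs => [|vs v _]; first by move=> _; apply: f1.
by rewrite size_rcons foldr_rcons; apply: fn.
Qed.

Lemma smooth_upto0 W D (f : V -> W) :
  (forall x, D x -> differentiable f x) -> smooth_upto 0 D f.
Proof. by move=> f1 [|//] _; apply: f1. Qed.

Lemma smooth_on_derive W D (f : V -> W) v :
  smooth_on D f -> smooth_on D ('D_v f).
Proof.
by move=> /smooth_onP fD; apply/smooth_onP => n; apply: smooth_upto_derive.
Qed.

(** The difference of the two functions vanishes near [x], so it has the zero
    map as a differential there. *)
Lemma near_eq_differentiable W (f g : V -> W) x :
  (\near x, f x = g x) -> differentiable f x -> differentiable g x.
Proof.
move=> fg fx; suff hx : differentiable (g - f) x.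
  by rewrite -(subrK f g); exact: differentiableD.
have h0 : \near x, (g - f) x = 0.
  near=> y; rewrite /= fctE; apply/eqP; rewrite subr_eq0 eq_sym; apply/eqP.
  by near: y.
have hx0 : (g - f) x = 0 := nbhs_singleton h0.
have oh : (g - f) \o shift x = cst ((g - f) x) + (\0 : V -> W) +o_ 0 id.
  apply/eqaddoP => e e0; near=> y.
  rewrite /= [X in `|X|](_ : _ = 0).
    by rewrite normr0 mulr_ge0 // ltW.
  rewrite -[LHS]/((g - f) (y + x) - ((g - f) x + 0)) hx0 addr0 subr0.
  by near: y; move: h0; rewrite (near_shift 0) subr0.
have c0 : continuous (\0 : V -> W) by move=> y; exact: cvg_cst.
apply/diff_locallyP.
by rewrite (diff_unique c0 oh); split.
Unshelve. all: by end_near. Qed.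

Lemma smooth_upto_ext W n D (f g : V -> W) : open D ->
  (forall x, D x -> f x = g x) -> smooth_upto n D f -> smooth_upto n D g.
Proof.
move=> oD; elim: n f g => [|n IHn] f g fg fD.
  apply: smooth_upto0 => x Dx; 
  apply: near_eq_differentiable (smooth_upto_differentiable Dx fD).
  by apply: filterS (open_nbhs_nbhs (conj oD Dx)).
apply: smooth_uptoS => [x Dx|v].
  apply: near_eq_differentiable (smooth_upto_differentiable Dx fD).
  by apply: filterS (open_nbhs_nbhs (conj oD Dx)).
apply: (IHn ('D_v f)); last exact: smooth_upto_derive.
move=> x Dx; apply: near_eq_derive.
by apply: filterS (open_nbhs_nbhs (conj oD Dx)).
Qed.

Lemma smooth_on_ext W D (f g : V -> W) : open D ->
  (forall x, D x -> f x = g x) -> smooth_on D f -> smooth_on D g.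
Proof.
move=> oD fg /smooth_onP fD; apply/smooth_onP => n.
exact: smooth_upto_ext fg _.
Qed.

Lemma smooth_upto_cst W n D (w : W) : smooth_upto n D (fun _ : V => w).
Proof.
have cst_derive v : 'D_v (fun _ : V => w) = fun _ => 0 :> W.
  by apply/funext => x; rewrite -[LHS]/('D_v (cst w) x) derive_cst.
elim: n w cst_derive => [|n IHn] w cst_derive.
  by apply: smooth_upto0 => x _; exact: differentiable_cst.
apply: smooth_uptoS => [x _|v]; first exact: differentiable_cst.
rewrite cst_derive; apply: IHn => u.
by apply/funext => x; rewrite -[LHS]/('D_u (cst 0) x) derive_cst.
Qed.

Lemma smooth_uptoD W n D (f g : V -> W) : open D ->
  smooth_upto n D f -> smooth_upto n D g -> smooth_upto n D (fun x => f x + g x).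
Proof.
move=> oD; elim: n f g => [|n IHn] f g fD gD.
  apply: smooth_upto0 => x Dx.
  apply: (@differentiableD _ _ _ f g x); first exact: (smooth_upto_differentiable Dx fD).
  exact: (smooth_upto_differentiable Dx gD).
apply: smooth_uptoS => [x Dx|v].
  apply: (@differentiableD _ _ _ f g x); first exact: (smooth_upto_differentiable Dx fD).
  exact: (smooth_upto_differentiable Dx gD).
apply: (@smooth_upto_ext _ _ _ (fun x => 'D_v f x + 'D_v g x)) => //.
  move=> x Dx; apply/esym; apply: (@deriveD _ _ _ f g);
    by apply: diff_derivable; apply: smooth_upto_differentiable Dx _; eassumption.
by apply: IHn; exact: smooth_upto_derive.
Qed.

Lemma smooth_uptoM n D (f g : V -> R) : open D ->
  smooth_upto n D f -> smooth_upto n D g -> smooth_upto n D (fun x => f x * g x).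
Proof.
move=> oD; elim: n f g => [|n IHn] f g fD gD.
  apply: smooth_upto0 => x Dx.
  apply: (@differentiableM _ _ f g x); first exact: (smooth_upto_differentiable Dx fD).
  exact: (smooth_upto_differentiable Dx gD).
apply: smooth_uptoS => [x Dx|v].
  apply: (@differentiableM _ _ f g x); first exact: (smooth_upto_differentiable Dx fD).
  exact: (smooth_upto_differentiable Dx gD).
apply: (@smooth_upto_ext _ _ _ (fun x => f x * 'D_v g x + g x * 'D_v f x)) => //.
  move=> x Dx; apply/esym; apply: (@deriveM _ _ f g);
    by apply: diff_derivable; apply: smooth_upto_differentiable Dx _; eassumption.
apply: smooth_uptoD => //.
  by apply: IHn; [exact: smooth_uptoW | exact: smooth_upto_derive].
by apply: IHn; [exact: smooth_uptoW | exact: smooth_upto_derive].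
Qed.

Lemma smooth_upto_sum W (I : Type) (r : seq I) n D (f : I -> V -> W) : open D ->
  (forall i, smooth_upto n D (f i)) ->
  smooth_upto n D (fun x => \sum_(i <- r) f i x).
Proof.
move=> oD fD; elim: r => [|i r IHr].
  by under eq_fun do rewrite big_nil; exact: smooth_upto_cst.
by under eq_fun do rewrite big_cons; apply: smooth_uptoD.
Qed.

Lemma smooth_upto_mxP n D p q (f : V -> 'M[R]_(p, q)) : open D ->
  smooth_upto n D f <-> forall i j, smooth_upto n D (fun x => f x i j).
Proof.
move=> oD; elim: n f => [|n IHn] f.
  split=> [fD i j|fD]; apply: smooth_upto0 => x Dx.
    move: i j; apply/differentiable_mxP.
    exact: (smooth_upto_differentiable Dx fD).
  apply/differentiable_mxP => i j.
  exact: (smooth_upto_differentiable Dx (fD _ _)).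
have fE x v i j : differentiable f x -> 'D_v f x i j = 'D_v (fun y => f y i j) x.
  by move=> fx; rewrite derive_mx ?mxE //; exact: diff_derivable.
split=> [fD i j|fD]; apply: smooth_uptoS.
- move=> x Dx; move: i j; apply/differentiable_mxP.
  exact: (smooth_upto_differentiable Dx fD).
- move=> v; apply: (@smooth_upto_ext _ _ _ (fun x => 'D_v f x i j)) => //.
    by move=> x Dx; apply: fE; exact: (smooth_upto_differentiable Dx fD).
  by move: i j; apply/IHn; exact: smooth_upto_derive.
- move=> x Dx; apply/differentiable_mxP => i j.
  exact: (smooth_upto_differentiable Dx (fD _ _)).
- move=> v; apply/IHn => i j.
  apply: (@smooth_upto_ext _ _ _ ('D_v (fun y => f y i j))) => //.
    move=> x Dx; apply/esym; apply: fE.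
    apply/differentiable_mxP => k l.
    exact: (smooth_upto_differentiable Dx (fD _ _)).
  by apply: smooth_upto_derive; exact: fD.
Qed.

Lemma smooth_upto_mulmx n D p q r (f : V -> 'M[R]_(p, q))
    (g : V -> 'M[R]_(q, r)) : open D ->
  smooth_upto n D f -> smooth_upto n D g ->
  smooth_upto n D (fun x => f x *m g x).
Proof.
move=> oD /(smooth_upto_mxP _ _ oD) fD /(smooth_upto_mxP _ _ oD) gD.
apply/smooth_upto_mxP => // i k; under eq_fun do rewrite mxE.
by apply: smooth_upto_sum => // j; exact: smooth_uptoM.
Qed.

End Smooth.

Section SmoothOn.
Context {R : realType} {V : normedModType R}.
Variables (D : set V) (oD : open D).

Lemma smooth_on_mxP p q (f : V -> 'M[R]_(p, q)) :
  smooth_on D f <-> forall i j, smooth_on D (fun x => f x i j).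
Proof.
split=> [/smooth_onP fD i j|fD]; apply/smooth_onP => n.
  by move: i j; apply/smooth_upto_mxP.
by apply/smooth_upto_mxP => // i j; move: n; apply/smooth_onP.
Qed.

Lemma smooth_on_cst (W : normedModType R) (w : W) :
  smooth_on D (fun _ : V => w).
Proof. by apply/smooth_onP => n; exact: smooth_upto_cst. Qed.

Lemma smooth_onD (W : normedModType R) (f g : V -> W) :
  smooth_on D f -> smooth_on D g -> smooth_on D (fun x => f x + g x).
Proof.
move=> /smooth_onP fD /smooth_onP gD; apply/smooth_onP => n.
exact: smooth_uptoD.
Qed.

Lemma smooth_onM (f g : V -> R) :
  smooth_on D f -> smooth_on D g -> smooth_on D (fun x => f x * g x).
Proof.
move=> /smooth_onP fD /smooth_onP gD; apply/smooth_onP => n.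
exact: smooth_uptoM.
Qed.

Lemma smooth_on_sum (W : normedModType R) (I : Type) (r : seq I)
    (f : I -> V -> W) : (forall i, smooth_on D (f i)) ->
  smooth_on D (fun x => \sum_(i <- r) f i x).
Proof.
move=> fD; apply/smooth_onP => n; apply: smooth_upto_sum => // i.
by move: n; apply/smooth_onP.
Qed.

Lemma smooth_on_mulmx p q r (f : V -> 'M[R]_(p, q)) (g : V -> 'M[R]_(q, r)) :
  smooth_on D f -> smooth_on D g -> smooth_on D (fun x => f x *m g x).
Proof.
move=> /smooth_onP fD /smooth_onP gD; apply/smooth_onP => n.
exact: smooth_upto_mulmx.
Qed.

Lemma smooth_on_scalemx p q (a : V -> R) (f : V -> 'M[R]_(p, q)) :
  smooth_on D a -> smooth_on D f -> smooth_on D (fun x => a x *: f x).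
Proof.
move=> aD /smooth_on_mxP fD; apply/smooth_on_mxP => i j.
by under eq_fun do rewrite mxE; exact: smooth_onM.
Qed.

Lemma smooth_onZ p q (a : R) (f : V -> 'M[R]_(p, q)) :
  smooth_on D f -> smooth_on D (fun x => a *: f x).
Proof. by apply: smooth_on_scalemx; exact: smooth_on_cst. Qed.

Lemma smooth_onN p q (f : V -> 'M[R]_(p, q)) :
  smooth_on D f -> smooth_on D (fun x => - f x).
Proof.
by move=> fD; under eq_fun do rewrite -scaleN1r; exact: smooth_onZ.
Qed.

Lemma smooth_onB p q (f g : V -> 'M[R]_(p, q)) :
  smooth_on D f -> smooth_on D g -> smooth_on D (fun x => f x - g x).
Proof. by move=> fD gD; apply: smooth_onD => //; exact: smooth_onN. Qed.

Lemma smooth_on_trmx p q (f : V -> 'M[R]_(p, q)) :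
  smooth_on D f -> smooth_on D (fun x => (f x)^T).
Proof.
move=> /smooth_on_mxP fD; apply/smooth_on_mxP => i j.
by under eq_fun do rewrite mxE; exact: fD.
Qed.

End SmoothOn.

Lemma smooth_on_id (R : realType) (V : normedModType R) (D : set V) :
  smooth_on D (@id V).
Proof.
move=> vs x Dx; elim/last_ind: vs => [|vs v _] /=; first by [].
rewrite foldr_rcons (_ : 'D_v id = fun _ => v); last first.
  by apply/funext => y; exact: derive_id.
exact: smooth_on_cst Dx.
Qed.

(** A smooth field differentiated along a smooth field is smooth: the
    directional derivative is linear in the direction. *)
Lemma smooth_on_derive_along (R : realType) p q
    (D : set 'M[R]_(p, q)) r s (X : 'M[R]_(p, q) -> 'M[R]_(p, q))
    (Y : 'M[R]_(p, q) -> 'M[R]_(r, s)) : open D ->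
  smooth_on D X -> smooth_on D Y -> smooth_on D (fun x => 'D_(X x) Y x).
Proof.
move=> oD XD YD.
apply: (@smooth_on_ext _ _ _ _
  (fun x => \sum_i \sum_j X x i j *: 'D_(delta_mx i j) Y x)) => //.
  move=> x Dx; rewrite deriveE; last exact: (smooth_on_differentiable Dx YD).
  rewrite {2}[X x]matrix_sum_delta linear_sum; apply: eq_bigr => i _.
  rewrite linear_sum; apply: eq_bigr => j _.
  by rewrite linearZ deriveE //; exact: (smooth_on_differentiable Dx YD).
apply: smooth_on_sum => // i; apply: smooth_on_sum => // j.
apply: smooth_on_scalemx => //; last exact: smooth_on_derive.
by move: i j; apply/smooth_on_mxP.
Qed.

Lemma cvg_mx (R : realType) m n (u : nat -> 'M[R]_(m, n)) (L : 'M[R]_(m, n)) :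
  (forall i j, (fun k => u k i j) @ \oo --> L i j) -> u @ \oo --> L.
Proof.
move=> uL; apply/cvgrPdist_le => e e0; near=> k.
rewrite /Num.Def.normr/= mx_normrE (bigmax_le _ (ltW e0))//= => i _.
rewrite !mxE/=; move: i; near: k; apply: filter_forall => /= i.
exact: ((cvgrPdist_le _ _).1 (uL i.1 i.2)).
Unshelve. all: by end_near. Qed.

(** * The matrix exponential *)

Section MatrixExponential.
Context {R : realType} (m : nat) (B : 'M[R]_m).

(** The entries of [t |-> expm (t *: B)] are power series in [t]; the shift
    [s] is there because differentiating such a series multiplies [B ^+ k] by [B]. *)
Definition exp_entry_coeff (s : nat) (i j : 'I_m) (k : nat) : R :=
  (k`!%:R)^-1 * (B ^+ (k + s)) i j.

Lemma pseries_diffs_exp_entry s i j :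
  pseries_diffs (exp_entry_coeff s i j) = exp_entry_coeff s.+1 i j.
Proof.
apply/funext => k; rewrite /pseries_diffs /exp_entry_coeff addnS -addSn.
rewrite factS natrM invfM mulrA mulrA divff ?mul1r // pnatr_eq0.
Qed.

Let b : R := \sum_i \sum_j `|B i j|.

Lemma exprmx_entry_bound k i j : `|(B ^+ k) i j| <= b ^+ k.
Proof.
have b0 : 0 <= b by apply: sumr_ge0 => ? _; apply: sumr_ge0.
elim: k i j => [|k IHk] i j.
  rewrite !expr0 mxE; case: (i == j); rewrite ?normr1 //.
  by rewrite normr0.
rewrite exprS mxE (le_trans (ler_norm_sum _ _ _)) //.
rewrite (@le_trans _ _ (\sum_l `|B i l| * b ^+ k)) //.
  by apply: ler_sum => l _; rewrite normrM ler_wpM2l.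
rewrite -mulr_suml exprS ler_wpM2r ?exprn_ge0 //.
rewrite [leRHS](bigD1 i) //= lerDl.
by apply: sumr_ge0 => ? _; apply: sumr_ge0.
Qed.

(** Comparison with the scalar exponential series of [b * `|x|], where [b] is
    the sum of the absolute values of the entries of [B]. *)
Lemma cvg_exp_entry s i j x : cvgn (pseries (exp_entry_coeff s i j) x).
Proof.
have b0 : 0 <= b by apply: sumr_ge0 => ? _; apply: sumr_ge0.
apply: normed_cvg.
apply: (@series_le_cvg _ _ (b ^+ s *: exp_coeff (b * `|x|))) => [k|k|k|].
- exact: normr_ge0.
- by rewrite mulr_ge0 ?exprn_ge0 // exp_coeff_ge0 // mulr_ge0.
- rewrite /exp_entry_coeff /= normrM normrX normrM.
  rewrite (ger0_norm (_ : 0 <= (k`!%:R)^-1)) ?invr_ge0 //.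
  rewrite -[X in _ <= X]/(b ^+ s * ((b * `|x|) ^+ k / k`!%:R)).
  rewrite exprMn (_ : b ^+ s * _ = k`!%:R^-1 * b ^+ (k + s) * `|x| ^+ k).
    by rewrite ler_wpM2r ?exprn_ge0 // ler_wpM2l ?invr_ge0 // exprmx_entry_bound.
  by rewrite exprD; ring.
- exact/is_cvg_seriesZ/is_cvg_series_exp_coeff.
Qed.

Lemma exprmxZ (t : R) k : (t *: B) ^+ k = t ^+ k *: B ^+ k.
Proof.
elim: k => [|k IHk]; first by rewrite !expr0 scale1r.
rewrite !exprS IHk -[LHS]/((t *: B) *m (t ^+ k *: B ^+ k)).
by rewrite -scalemxAl -scalemxAr scalerA.
Qed.

Lemma expm_entry t i j :
  expm (t *: B) i j = limn (pseries (exp_entry_coeff 0 i j) t).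
Proof.
rewrite /expm (_ : lim _ =
  \matrix_(i, j) limn (pseries (exp_entry_coeff 0 i j) t)) ?mxE //.
apply: cvg_lim => //; apply: cvg_mx => k l; rewrite mxE.
rewrite (_ : (fun _ => _) = pseries (exp_entry_coeff 0 k l) t).
  exact: cvg_exp_entry.
apply/funext => n; rewrite /series /= /pseries /series /= summxE.
by apply: eq_bigr => p _; rewrite /exp_entry_coeff exprmxZ !mxE addn0; ring.
Qed.

Lemma limn_exp_entry1_mull t i j :
  limn (pseries (exp_entry_coeff 1 i j) t) = (B *m expm (t *: B)) i j.
Proof.
rewrite mxE; apply: cvg_lim => //.
rewrite (_ : pseries _ _ = fun n =>
  \sum_l B i l * pseries (exp_entry_coeff 0 l j) t n).
  apply: cvg_big => [|l _]; first exact: add_continuous.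
  by apply: cvgMl_tmp; rewrite expm_entry; exact: cvg_exp_entry.
apply/funext => n; rewrite /pseries /series /=.
under [RHS]eq_bigr do rewrite mulr_sumr.
rewrite exchange_big; apply: eq_bigr => p _.
rewrite /exp_entry_coeff addn1 exprS mxE mulr_sumr mulr_suml.
by apply: eq_bigr => l _; rewrite addn0; ring.
Qed.

Lemma limn_exp_entry1_mulr t i j :
  limn (pseries (exp_entry_coeff 1 i j) t) = (expm (t *: B) *m B) i j.
Proof.
rewrite mxE; apply: cvg_lim => //.
rewrite (_ : pseries _ _ = fun n =>
  \sum_l pseries (exp_entry_coeff 0 i l) t n * B l j).
  apply: cvg_big => [|l _]; first exact: add_continuous.
  by apply: cvgMr_tmp; rewrite expm_entry; exact: cvg_exp_entry.
apply/funext => n; rewrite /pseries /series /=.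
under [RHS]eq_bigr do rewrite mulr_suml.
rewrite exchange_big; apply: eq_bigr => p _.
rewrite /exp_entry_coeff addn1 exprSr mxE mulr_sumr mulr_suml.
by apply: eq_bigr => l _; rewrite addn0; ring.
Qed.

Lemma expm_mulmxC t : expm (t *: B) *m B = B *m expm (t *: B).
Proof.
apply/matrixP => i j.
by rewrite -limn_exp_entry1_mull limn_exp_entry1_mulr.
Qed.

Lemma is_derive_expm t :
  is_derive t (1 : R) (fun t => expm (t *: B)) (B *m expm (t *: B)).
Proof.
apply/is_derive_mxP => i j; under eq_fun do rewrite expm_entry.
have := @pseries_snd_diffs R (exp_entry_coeff 0 i j) (`|t| + 1) t.
rewrite !pseries_diffs_exp_entry => /(_ (@cvg_exp_entry _ _ _ _)).
move=> /(_ (@cvg_exp_entry _ _ _ _)) /(_ (@cvg_exp_entry _ _ _ _)).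
rewrite [`|_ + 1|]ger0_norm ?addr_ge0 // ltrDl ltr01 => /(_ isT) dexp.
by apply: is_derive_eq dexp _; exact: limn_exp_entry1_mull.
Qed.

Lemma expm0 : expm (0 *: B) = 1%:M.
Proof.
apply/matrixP => i j; rewrite expm_entry; apply: cvg_lim => //.
(* after the first term, all the partial sums at 0 are equal to [B ^+ 0] *)
rewrite -(cvg_shiftn 1) (_ : (fun _ => _) = cst ((1%:M : 'M[R]_m) i j)).
  exact: cvg_cst.
apply/funext => n; rewrite /pseries /series /= addn1 big_nat_recl //.
rewrite big1 => [|p _].
  by rewrite /exp_entry_coeff fact0 !expr0 invr1 mulr1 mul1r addr0.
by rewrite exprS mul0r mulr0.
Qed.

(** Every derivative of [t |-> expm (t *: B)] is a constant multiple of it. *)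
Lemma smooth_on_expm : smooth_on setT (fun t : R => expm (t *: B)).
Proof.
have d1 t : differentiable (fun t : R => expm (t *: B)) t.
  by apply/derivable1_diffP; case: (is_derive_expm t).
have dE t v : 'D_v (fun t : R => expm (t *: B)) t = v *: (B *m expm (t *: B)).
  rewrite deriveE // -[v in LHS](mulr1 v) [LHS]linearZ -deriveE //.
  by case: (is_derive_expm t) => _ ->.
apply/smooth_onP; elim=> [|n IHn]; first exact: smooth_upto0.
apply: smooth_uptoS => [//|v].
rewrite (_ : 'D_v _ = fun t => v%:M *m (B *m expm (t *: B))); last first.
  by apply/funext => t; rewrite mul_scalar_mx; exact: dE.
apply: smooth_upto_mulmx; [exact: openT | exact: smooth_upto_cst |].
by apply: smooth_upto_mulmx; [exact: openT | exact: smooth_upto_cst |].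
Qed.

End MatrixExponential.

(** * Linear differential equations on an interval *)

Lemma is_derive0_interval_cst (R : realType) m n (I : set R)
    (f : R -> 'M[R]_(m, n)) : is_interval I ->
  (forall t, I t -> is_derive t (1 : R) f 0) ->
  forall s t, I s -> I t -> f s = f t.
Proof.
move=> itvI df s t; wlog st : s t / s <= t.
  by move=> H Is It; case: (leP s t) => [|/ltW] /H ->.
move=> Is It; apply/matrixP => i j.
have Iz z : z \in `[s, t]%R -> I z by rewrite in_itv /=; exact: itvI Is It z.
have dfij z : z \in `[s, t]%R -> is_derive z (1 : R) (fun z => f z i j) 0.
  by move=> /Iz /df /is_derive_mxP /(_ i j); rewrite mxE.
have dfijo z : z \in `]s, t[%R -> is_derive z (1 : R) (fun z => f z i j) 0.
  by move=> zst; apply: dfij; exact: subset_itv_oo_cc zst.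
have [|z _] := MVT_segment st dfijo.
  by apply: derivable_within_continuous => z /dfij [].
by rewrite mul0r => /eqP; rewrite subr_eq0 => /eqP.
Qed.

(** Multiplying a solution of [Y' = B Y] by [expm (- t B)] gives a constant. *)
Lemma linear_ode_interval_aux (R : realType) m n (B : 'M[R]_m) (I : set R)
    (Y : R -> 'M[R]_(m, n)) : is_interval I -> I 0 ->
  (forall t, I t -> is_derive t (1 : R) Y (B *m Y t)) ->
  forall t, I t -> expm (t *: - B) *m Y t = Y 0.
Proof.
move=> itvI I0 dY t It.
rewrite -[RHS]mul1mx -(expm0 (- B)).
apply: (@is_derive0_interval_cst _ _ _ I (fun t => expm (t *: - B) *m Y t)) => //.
move=> {It}t It.
apply: is_derive_eq (is_derive_mulmx (is_derive_expm (- B) t) (dY t It)) _.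
by rewrite -expm_mulmxC mulmxN mulNmx -mulmxA addNr.
Qed.

Lemma linear_ode_interval (R : realType) m n (B : 'M[R]_m) (I : set R)
    (Y : R -> 'M[R]_(m, n)) : is_interval I -> I 0 ->
  (forall t, I t -> is_derive t (1 : R) Y (B *m Y t)) ->
  forall t, I t -> Y t = expm (t *: B) *m Y 0.
Proof.
move=> itvI I0 dY t It.
have itvT : is_interval [set: R] by [].
have VE : expm (t *: - B) *m expm (t *: B) = 1%:M.
  rewrite -(expm0 B); apply: (@linear_ode_interval_aux _ _ _ B setT
    (fun t => expm (t *: B))) => // s _.
  exact: is_derive_expm.
rewrite -(linear_ode_interval_aux itvI I0 dY It) mulmxA.
by rewrite (mulmx1C VE) mul1mx.
Qed.

(** * Uniqueness of the connection and of the covariant derivative *)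

Lemma is_derive_comp_curve (R : realType) (V W : normedModType R)
    (Y : V -> W) (c : R -> V) (t : R) :
  differentiable Y (c t) -> differentiable c t ->
  is_derive t (1 : R) (Y \o c) ('D_(c^`()%classic t) Y (c t)).
Proof.
move=> dY dc.
have dYc : differentiable (Y \o c) t by exact: differentiable_comp.
apply: DeriveDef; first exact: diff_derivable.
by rewrite deriveE // diff_comp //= deriveE // derive1E' .
Qed.

(** The difference of two such connections, paired with a third field, is
    symmetric in its first two arguments (both are torsion-free) and
    antisymmetric in the last two (both are metric), hence zero. *)
Lemma levi_civita_unique (R : realType) (V : normedModType R) (M : set V)
    (T : V -> set V) (g : V -> V -> V -> R)
    (nabla1 nabla2 : (V -> V) -> (V -> V) -> V -> V) :
  (forall p u v w, g p (u - v) w = g p u w - g p v w) ->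
  (forall p u v, g p u v = g p v u) ->
  levi_civita M T g nabla1 -> levi_civita M T g nabla2 ->
  forall X Y Z, vector_field M T X -> vector_field M T Y ->
    vector_field M T Z -> forall p, M p ->
  g p (nabla1 X Y p - nabla2 X Y p) (Z p) = 0.
Proof.
move=> gB gC lc1 lc2 X0 Y0 Z0 hX0 hY0 hZ0 p Mp.
pose S X Y Z := g p (nabla1 X Y p - nabla2 X Y p) (Z p).
have Ssym X Y Z : vector_field M T X -> vector_field M T Y -> S X Y Z = S Y X Z.
  move=> hX hY; rewrite /S; congr (g p _ _).
  have := lc_torsion_free lc1 hX hY Mp; rewrite -(lc_torsion_free lc2 hX hY Mp).
  move=> /eqP; rewrite subr_eq => /eqP ->.
  by rewrite addrAC [_ - nabla2 Y X p]addrC addrK addrC.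
have Santi X Y Z : vector_field M T X -> vector_field M T Y ->
    vector_field M T Z -> S X Y Z = - S X Z Y.
  move=> hX hY hZ; rewrite /S !gB [g p _ (Z p)]gC.
  have := lc_metric lc1 hX hY hZ Mp; rewrite (lc_metric lc2 hX hY hZ Mp).
  rewrite (gC p (Z p)) [g p (nabla1 X Z p) _]gC [g p (nabla2 X Z p) _]gC => h.
  lra.
rewrite -/(S X0 Y0 Z0); have : S X0 Y0 Z0 = - S X0 Y0 Z0.
  rewrite {1}Santi // {1}Ssym // {1}Santi // opprK {1}Ssym // {1}Santi //.
  by rewrite {1}Ssym.
by move=> h; lra.
Qed.

Section CovariantDerivative.
Context {R : realType} {V : normedModType R}.
Variables (M : set V) (T : V -> set V).
Variables (nabla : (V -> V) -> (V -> V) -> V -> V) (I : set R) (c : R -> V).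
Variable D : (R -> V) -> R -> V.
Hypotheses (oI : open I) (cM : forall t, I t -> M (c t)).
Hypothesis T0 : forall p, M p -> T p 0.
Hypothesis covD : covariant_derivative_along M T nabla I c D.

(** Multiplying a field which vanishes on [I] by the indicator function of the
    complement of [I] does not change it, whereas the Leibniz rule then makes
    its covariant derivative vanish on [I]. *)
Lemma covariant_derivative_eq_on Z1 Z2 :
  field_along T I c Z1 -> field_along T I c Z2 ->
  (forall t, I t -> Z1 t = Z2 t) -> forall t, I t -> D Z1 t = D Z2 t.
Proof.
move=> hZ1 hZ2 Z12 t It.
pose W s := Z1 s - Z2 s.
have W0 s : I s -> W s = 0 by move=> /Z12 Zs; rewrite /W Zs subrr.
have hW : field_along T I c W.
  split=> [|s Is]; last by rewrite W0 //; apply/T0/cM.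
  apply: (@smooth_on_ext _ _ _ _ (fun=> 0)) => // [s Is|]; first by rewrite W0.
  exact: smooth_on_cst.
(* [f] vanishes on the open set [I], so it is smooth there, and [f *: W = W] *)
pose f (s : R) : R := if s \in I then 0 else 1.
have f0 s : I s -> f s = 0 by move=> Is; rewrite /f mem_set.
have hf : smooth_on I f.
  apply: (@smooth_on_ext _ _ _ _ (fun=> 0)) => // [s Is|]; first by rewrite f0.
  exact: smooth_on_cst.
have -> : Z1 = Z2 \+ W by apply/funext => s; rewrite /W /= addrC subrK.
rewrite (cd_add covD hZ2 hW It) (_ : W = fun s => f s *: W s).
  rewrite (cd_leibniz covD hf hW It) W0 // scaler0 f0 // scale0r !addr0.
  by [].
apply/funext => s; rewrite /f; case: ifPn => [|_]; last by rewrite scale1r.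
by rewrite inE => Is; rewrite W0 // scaler0.
Qed.

End CovariantDerivative.

Section CovariantDerivativeFormula.
Context {R : realType} {a b : nat}.
Local Notation V := 'M[R]_(a, b).
Variables (M : set V) (T : V -> set V).
Variables (nabla : (V -> V) -> (V -> V) -> V -> V) (I : set R) (c : R -> V).
Variable D : (R -> V) -> R -> V.
Hypotheses (oI : open I) (cM : forall t, I t -> M (c t)).
Hypothesis covD : covariant_derivative_along M T nabla I c D.
Hypothesis T0 : forall p, M p -> T p 0.
Hypothesis TD : forall p u v, M p -> T p u -> T p v -> T p (u + v).
Hypothesis TZ : forall p (x : R) u, M p -> T p u -> T p (x *: u).

Lemma covariant_derivative_frame_sum (J : Type) (r : seq J) (E : J -> V -> V)
    (f : J -> R -> R) :
  (forall j, field_along T I c (E j \o c)) ->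
  (forall j, smooth_on I (f j)) ->
  field_along T I c (fun s => \sum_(j <- r) f j s *: E j (c s)) /\
  forall t, I t -> D (fun s => \sum_(j <- r) f j s *: E j (c s)) t =
    \sum_(j <- r) (derive1 (f j) t *: E j (c t) + f j t *: D (E j \o c) t).
Proof.
move=> hE hf.
have hfE j : field_along T I c (fun s => f j s *: E j (c s)).
  have [sE tE] := hE j; split => [|t It]; last exact/TZ/tE/It/cM.
  exact: smooth_on_scalemx.
elim: r => [|j r [IH1 IH2]].
  have h0 : field_along T I c (fun=> 0).
    by split=> [|t It]; [exact: smooth_on_cst | exact/T0/cM].
  under [in X in X /\ _]eq_fun do rewrite big_nil; split=> // t It.
  rewrite big_nil (_ : (fun _ => _) = fun s => (fun=> 0 : R) s *: (0 : V)).
    rewrite (cd_leibniz covD (@smooth_on_cst _ _ I _ _) h0 It).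
    by rewrite derive1_cst !scale0r addr0.
  by apply/funext => s; rewrite big_nil scaler0.
have -> : (fun s => \sum_(i <- j :: r) f i s *: E i (c s)) =
    (fun s => f j s *: E j (c s)) \+ (fun s => \sum_(i <- r) f i s *: E i (c s)).
  by apply/funext => s; rewrite big_cons.
split=> [|t It].
  have [s1 t1] := hfE j; have [s2 t2] := IH1; split; first exact: smooth_onD.
  by move=> t It; apply: TD; [exact: cM | exact: t1 | exact: t2].
rewrite (cd_add covD (hfE j) IH1 It) IH2 // big_cons.
by rewrite (cd_leibniz covD (hf j) (hE j) It).
Qed.

Variable P : V -> V -> V.
Hypothesis Pfield : forall v, vector_field M T (P^~ v).
Hypothesis Pid : forall p v, M p -> T p v -> P p v = v.
Hypothesis Plin : forall p, linear (P p).
Hypothesis Psmooth : forall v, smooth_on I (fun s => P (c s) v).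

Variable G : V -> V -> V -> V.
Hypothesis Glin : forall p u, linear (G p u).
Hypothesis nablaE : forall X Y, vector_field M T X -> vector_field M T Y ->
  forall p, M p -> nabla X Y p = 'D_(X p) Y p + G p (X p) (Y p).

Lemma linear_mx_sum (W : lmodType R) (f : V -> W) (u : V) : linear f ->
  f u = \sum_(ij : 'I_a * 'I_b) u ij.1 ij.2 *: f (delta_mx ij.1 ij.2).
Proof.
move=> lf; pose fM := GRing.isLinear.Build _ _ _ _ _ lf.
pose fL : {linear _ -> _} := HB.pack f fM.
rewrite -[f u]/(fL u) {1}[u]matrix_sum_delta pair_bigA linear_sum.
by apply: eq_bigr => ij _; rewrite linearZ.
Qed.

(** The formula for [nabla] determines [D]: a field [Z] along [c] is
    [\sum_ij Z_ij P(E_ij)], where the [P(E_ij)] are restrictions to [c] of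
    globally defined fields, on which [D] is induced by [nabla]. *)
Lemma covariant_derivative_formula Z : smooth_on I c ->
  (forall t, I t -> T (c t) (c^`()%classic t)) -> field_along T I c Z ->
  forall t, I t -> D Z t = 'D_1 Z t + G (c t) (c^`()%classic t) (Z t).
Proof.
move=> sc tc hZ t It; have [sZ tZ] := hZ.
pose E (ij : 'I_a * 'I_b) p := P p (delta_mx ij.1 ij.2).
pose f (ij : 'I_a * 'I_b) s := Z s ij.1 ij.2.
have hE ij : field_along T I c (E ij \o c).
  by split=> [|s Is]; [exact: Psmooth | apply: (Pfield _).2; exact: cM].
have hf ij : smooth_on I (f ij).
  by apply: (smooth_on_mxP oI Z).1.
have [hZ' DZ'] := covariant_derivative_frame_sum (index_enum _) hE hf.
have ZE s : I s -> \sum_ij f ij s *: E ij (c s) = Z s.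
  move=> Is; rewrite -[RHS](Pid (cM Is)); last exact: tZ.
  by rewrite [RHS]linear_mx_sum.
rewrite -(covariant_derivative_eq_on oI cM T0 covD hZ' hZ ZE It) DZ' //.
have nearI : \near t, I t by exact: open_nbhs_nbhs.
have dE ij : is_derive t (1 : R) (E ij \o c) ('D_(c^`()%classic t) (E ij) (c t)).
  apply: is_derive_comp_curve; last exact: smooth_on_differentiable It sc.
  by apply: smooth_on_differentiable (Pfield _).1.
have df ij : is_derive t (1 : R) (f ij) (derive1 (f ij) t).
  rewrite derive1E; apply: derivableP; apply: diff_derivable.
  exact: smooth_on_differentiable It (hf ij).
have dZ : 'D_1 Z t = \sum_ij (derive1 (f ij) t *: E ij (c t) +
    f ij t *: 'D_(c^`()%classic t) (E ij) (c t)).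
  rewrite -(@near_eq_derive _ _ _ (fun s => \sum_ij f ij s *: E ij (c s))).
    apply: derive_val; apply: is_derive_big => ij.
    exact: is_derive_scalemx (df ij) (dE ij).
  near=> s; apply: ZE; by near: s.
pose GM := GRing.isLinear.Build _ _ _ _ _ (Glin (c t) (c^`()%classic t)).
pose GL : {linear _ -> _} := HB.pack (G (c t) (c^`()%classic t)) GM.
rewrite dZ -[Z t in RHS]ZE // -[G _ _]/(GL : _ -> _) linear_sum -big_split.
apply: eq_bigr => ij _; rewrite linearZ /= -addrA -scalerDr.
congr (_ + _ *: _).
have Pc : P (c t) (c^`()%classic t) = c^`()%classic t.
  by apply: Pid; [exact: cM | exact: tc].
have hPE : vector_field M T (E ij) by exact: Pfield.
rewrite (cd_induced covD (Pfield (c^`()%classic t)) hPE It Pc).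
by rewrite nablaE ?Pc //; exact: cM.
Unshelve. all: by end_near. Qed.

End CovariantDerivativeFormula.

(** * The symplectic inverse *)

Section EntrywiseModule.
Context {R : realType} {m n : nat}.
Implicit Types A B : 'M[R]_(m, n).

Lemma addmxE A B i j : (A + B) i j = A i j + B i j.
Proof. by rewrite mxE. Qed.

Lemma oppmxE A i j : (- A) i j = - A i j.
Proof. by rewrite mxE. Qed.

Lemma scalemxE x A i j : (x *: A) i j = x * A i j.
Proof. by rewrite mxE. Qed.

Lemma zeromxE i j : (0 : 'M[R]_(m, n)) i j = 0.
Proof. by rewrite mxE. Qed.

End EntrywiseModule.

(** Linear arithmetic over matrices, products being treated as atoms *)
Ltac mx_lra :=
  apply/matrixP => ? ?; rewrite ?(addmxE, oppmxE, scalemxE, zeromxE); lra.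

Ltac mx_expand :=
  rewrite ?(mulmxDl, mulmxDr, mulmxBl, mulmxBr, mulNmx, mulmxN,
    =^~ scalemxAl, =^~ scalemxAr, mulmxA, mulmx0, mul0mx, mulmx1, mul1mx).

(** [sympinv] is itself a product of matrices, which rewriting with [mulmxA]
    would open; the algebra below is done with this locked copy. *)
HB.lock Definition splus (R : realType) (a b : nat) (A : 'M[R]_(a + a, b + b)) :=
  sympinv A.

Local Notation "A ^[*]" := (splus A) (at level 2, format "A ^[*]") : ring_scope.

Lemma splusE (R : realType) a b (A : 'M[R]_(a + a, b + b)) : A^[*] = A^[+].
Proof. by rewrite splus.unlock. Qed.

Lemma mxtraceN (R : realType) m (A : 'M[R]_m) : \tr (- A) = - \tr A.
Proof. exact: linearN. Qed.

Ltac tr_expand := rewrite ?(mxtraceD, mxtraceN, mxtraceZ).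

(** The trace form is nondegenerate: test against the matrix units. *)
Lemma mxtrace_mul_eq0 (R : realType) m n (A : 'M[R]_(m, n)) :
  (forall B, \tr (A *m B) = 0) -> A = 0.
Proof.
move=> A0; apply/matrixP => i j; rewrite !mxE -(A0 (delta_mx j i)).
rewrite /mxtrace (bigD1 i) //= big1 => [|l li].
  rewrite !mxE (bigD1 j) //= big1 => [|l lj]; rewrite !mxE ?eqxx.
    by rewrite mulr1 !addr0.
  by rewrite (negPf lj) mulr0.
by rewrite mxE big1 // => q _; rewrite mxE (negPf li) andbF mulr0.
Qed.

Section SymplecticInverse.
Context {R : realType}.

Lemma Jmx_trmxK a : Jmx R a *m (Jmx R a)^T = 1%:M.
Proof.
rewrite /Jmx tr_block_mx mulmx_block !trmx0 trmx1 linearN /= trmx1.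
rewrite !mulmx0 !mul0mx !mulmx1 !mulmxN mulmx1 opprK !addr0 !add0r.
by rewrite -scalar_mx_block.
Qed.

Lemma trmx_Jmx a : (Jmx R a)^T = - Jmx R a.
Proof.
rewrite /Jmx tr_block_mx !trmx0 trmx1 linearN /= trmx1.
by rewrite opp_block_mx !oppr0 opprK.
Qed.

Lemma splusD a b (A B : 'M[R]_(a + a, b + b)) :
  (A + B)^[*] = A^[*] + B^[*].
Proof. by rewrite !splusE /sympinv linearD /= mulmxDr mulmxDl. Qed.

Lemma splusN a b (A : 'M[R]_(a + a, b + b)) : (- A)^[*] = - A^[*].
Proof. by rewrite !splusE /sympinv linearN /= mulmxN mulNmx. Qed.

Lemma splusZ a b x (A : 'M[R]_(a + a, b + b)) : (x *: A)^[*] = x *: A^[*].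
Proof. by rewrite !splusE /sympinv linearZ /= -scalemxAr -scalemxAl. Qed.

Lemma splusM a b c (A : 'M[R]_(a + a, b + b)) (B : 'M[R]_(b + b, c + c)) :
  (A *m B)^[*] = B^[*] *m A^[*].
Proof.
rewrite !splusE /sympinv trmx_mul !mulmxA; congr (_ *m _ *m _).
by rewrite -[in RHS]mulmxA Jmx_trmxK mulmx1.
Qed.

Lemma splusK a b (A : 'M[R]_(a + a, b + b)) : A^[*]^[*] = A.
Proof.
rewrite !splusE /sympinv !trmx_mul !trmxK !trmx_Jmx !mulNmx !mulmxN.
rewrite !mulmxA !mulNmx opprK.
have JJ c : Jmx R c *m Jmx R c = - 1%:M.
  by rewrite -(Jmx_trmxK c) trmx_Jmx mulmxN opprK.
by rewrite JJ -!mulmxA JJ mulNmx mulmxN mul1mx mulmx1 opprK.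
Qed.

Lemma splus1 a : (1%:M : 'M[R]_(a + a))^[*] = 1%:M.
Proof.
by rewrite !splusE /sympinv trmx1 mulmx1; apply: mulmx1C; exact: Jmx_trmxK.
Qed.

Lemma mxtrace_splus a (A : 'M[R]_(a + a)) : \tr A^[*] = \tr A.
Proof.
by rewrite splusE /sympinv mxtrace_mulC mulmxA Jmx_trmxK mul1mx mxtrace_tr.
Qed.

End SymplecticInverse.

Ltac symp_expand := rewrite ?(splusD, splusN, splusZ, splusM, splusK).

(** * The momentum matrix and the Christoffel form *)

Section StiefelAlgebra.
Context {R : realType} {n k : nat}.
Local Notation V := 'M[R]_(n + n, k + k).
Implicit Types p X Y Z : V.

(** The horizontal lift of the tangent vector [X] at [p] to the Lie algebra of
    the symplectic group: the Hamiltonian matrix [W] with [W p = X] and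
    [(1 - p p^+) W (1 - p p^+) = 0]. It is the momentum that is conserved along
    geodesics. *)
Definition momentum p X : 'M[R]_(n + n) :=
  X *m p^[*] - p *m X^[*] - p *m p^[*] *m X *m p^[*].

Definition christoffel p X Y : V :=
  - 2^-1 *: (momentum p X *m Y + momentum p Y *m X).

(** The projection onto the tangent space at [p] along the space of the [p *m S]
    with [S^+ = S], which is orthogonal to it for the metric. *)
Definition tangent_proj p X : V :=
  X - 2^-1 *: (p *m (p^[*] *m X + X^[*] *m p)).

Lemma SpStP p : SpSt p <-> p^[*] *m p = 1%:M.
Proof. by rewrite splusE. Qed.

Lemma TSpStP p X : TSpSt p X <-> X^[*] *m p = - (p^[*] *m X).
Proof. by rewrite /TSpSt /sp /mkset -!splusE splusM splusK. Qed.

Lemma momentum_skew p X : TSpSt p X -> (momentum p X)^[*] = - momentum p X.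
Proof.
move=> /TSpStP TX; rewrite /momentum; symp_expand; mx_expand.
rewrite -(mulmxA p X^[*] p) TX; mx_expand; mx_lra.
Qed.

Lemma momentum_apply p X : SpSt p -> TSpSt p X -> momentum p X *m p = X.
Proof.
move=> /[dup] Mp /SpStP pp /TSpStP TX; rewrite /momentum; mx_expand.
rewrite -!(mulmxA _ p^[*] p) pp !mulmx1 -(mulmxA p X^[*] p) TX; mx_expand; mx_lra.
Qed.

Lemma momentum_equivariant (E : 'M[R]_(n + n)) p X : E^[*] *m E = 1%:M ->
  momentum (E *m p) (E *m X) = E *m momentum p X *m E^[*].
Proof.
move=> EE; rewrite /momentum; symp_expand; mx_expand.
by rewrite -(mulmxA _ E^[*] E) EE mulmx1.
Qed.

Lemma christoffelC p X Y : christoffel p X Y = christoffel p Y X.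
Proof. by rewrite /christoffel addrC. Qed.

Lemma christoffel_linear p X : linear (christoffel p X).
Proof.
move=> x Y Z; rewrite /christoffel /momentum; symp_expand; mx_expand; mx_lra.
Qed.

Lemma christoffelDr p X Y Z :
  christoffel p X (Y + Z) = christoffel p X Y + christoffel p X Z.
Proof. by rewrite -[Y]scale1r christoffel_linear !scale1r. Qed.

Lemma christoffelZr p X x Y : christoffel p X (x *: Y) = x *: christoffel p X Y.
Proof.
rewrite /christoffel /momentum; symp_expand; mx_expand; mx_lra.
Qed.

Lemma christoffelDl p X Y Z :
  christoffel p (X + Y) Z = christoffel p X Z + christoffel p Y Z.
Proof. by rewrite christoffelC christoffelDr !(christoffelC p Z). Qed.

Lemma christoffelZl p X x Y : christoffel p (x *: X) Y = x *: christoffel p X Y.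
Proof. by rewrite christoffelC christoffelZr (christoffelC p Y). Qed.

Lemma tangent_proj_linear p : linear (tangent_proj p).
Proof. move=> x Y Z; rewrite /tangent_proj; symp_expand; mx_expand; mx_lra. Qed.

Lemma tangent_projT p X : SpSt p -> TSpSt p (tangent_proj p X).
Proof.
move=> /SpStP pp; apply/TSpStP.
rewrite /tangent_proj; symp_expand; mx_expand.
rewrite -!(mulmxA _ p^[*] p) pp; mx_expand; mx_lra.
Qed.

Lemma tangent_proj_id p X : TSpSt p X -> tangent_proj p X = X.
Proof.
move=> /TSpStP TX; rewrite /tangent_proj TX; mx_expand; mx_lra.
Qed.

Lemma TSpSt0 p : TSpSt p 0.
Proof.
apply/TSpStP; rewrite -[0](scale0r 0) splusZ !scale0r.
by rewrite mul0mx mulmx0 oppr0.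
Qed.

Lemma TSpStD p X Y : TSpSt p X -> TSpSt p Y -> TSpSt p (X + Y).
Proof.
move=> /TSpStP TX /TSpStP TY; apply/TSpStP.
by rewrite splusD mulmxDl mulmxDr TX TY opprD.
Qed.

Lemma TSpStZ p x X : TSpSt p X -> TSpSt p (x *: X).
Proof.
move=> /TSpStP TX; apply/TSpStP.
by rewrite splusZ -scalemxAl -scalemxAr TX scalerN.
Qed.

Lemma momentum_mul p X Y : momentum p X *m Y =
  X *m (p^[*] *m Y) - p *m (X^[*] *m Y) - p *m (p^[*] *m X) *m (p^[*] *m Y).
Proof. by rewrite /momentum; mx_expand. Qed.

Lemma splus_mul_christoffel p X Y : SpSt p ->
  p^[*] *m christoffel p X Y = 2^-1 *: (X^[*] *m Y + Y^[*] *m X).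
Proof.
move=> /[dup] Mp /SpStP pp; rewrite /christoffel !momentum_mul; mx_expand.
by rewrite pp; mx_expand; mx_lra.
Qed.

Lemma hSpStE p X Y : hSpSt p X Y =
  \tr (X^[*] *m Y) - 2^-1 * \tr (X^[*] *m p *m p^[*] *m Y).
Proof.
by rewrite /hSpSt -!splusE; mx_expand; rewrite linearB linearZ.
Qed.

Lemma hSpStC p X Y : hSpSt p X Y = hSpSt p Y X.
Proof.
rewrite !hSpStE; congr (_ - _ * _); rewrite -mxtrace_splus; symp_expand;
  by rewrite ?mulmxA.
Qed.

Lemma hSpStBl p X Y Z : hSpSt p (X - Y) Z = hSpSt p X Z - hSpSt p Y Z.
Proof.
rewrite !hSpStE; symp_expand; mx_expand; tr_expand; lra.
Qed.

Lemma hSpStDl p X Y Z : hSpSt p (X + Y) Z = hSpSt p X Z + hSpSt p Y Z.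
Proof. by rewrite !hSpStE; symp_expand; mx_expand; tr_expand; lra. Qed.

(** The terms of [christoffel p X Y] that are not in the right-hand side
    cancel in pairs: [p^+ Z] being Hamiltonian, the trace of its product with a matrix [A]
    changes sign when [A] is replaced by [A^+]. *)
Lemma hSpSt_christoffel p X Y Z : SpSt p -> TSpSt p X -> TSpSt p Y ->
  TSpSt p Z -> hSpSt p (christoffel p X Y) Z =
  2^-1 * (\tr (p^[*] *m Y *m X^[*] *m Z) + \tr (p^[*] *m X *m Y^[*] *m Z)).
Proof.
move=> /[dup] Mp /SpStP pp TX TY TZ.
have trN (A C : 'M[R]_(k + k)) : C^[*] = - C -> \tr (A^[*] *m C) = - \tr (A *m C).
  move=> CN; rewrite -mxtrace_splus splusM splusK CN mulNmx linearN /=.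
  by rewrite mxtrace_mulC.
have TN W : TSpSt p W -> (p^[*] *m W)^[*] = - (p^[*] *m W).
  by move=> /TSpStP TW; rewrite splusM splusK.
have f1 : \tr (X^[*] *m Y *m (p^[*] *m Z)) = - \tr (Y^[*] *m X *m (p^[*] *m Z)).
  by rewrite -trN ?TN // splusM splusK.
have f2 : \tr (p^[*] *m Y *m (p^[*] *m X) *m (p^[*] *m Z)) =
    - \tr (p^[*] *m X *m (p^[*] *m Y) *m (p^[*] *m Z)).
  by rewrite -trN ?TN // splusM !TN // mulmxN !mulNmx opprK.
have Gp : (christoffel p X Y)^[*] *m p = 2^-1 *: (X^[*] *m Y + Y^[*] *m X).
  have -> : (christoffel p X Y)^[*] *m p = (p^[*] *m christoffel p X Y)^[*].
    by rewrite splusM splusK.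
  by rewrite splus_mul_christoffel //; symp_expand; rewrite addrC.
have GE : (christoffel p X Y)^[*] *m Z = 2^-1 *: (
    p^[*] *m Y *m X^[*] *m Z + Y^[*] *m X *m (p^[*] *m Z)
    + p^[*] *m Y *m (p^[*] *m X) *m (p^[*] *m Z)
    + p^[*] *m X *m Y^[*] *m Z + X^[*] *m Y *m (p^[*] *m Z)
    + p^[*] *m X *m (p^[*] *m Y) *m (p^[*] *m Z)).
  rewrite /christoffel !momentum_mul; symp_expand.
  rewrite (TSpStP p X).1 // (TSpStP p Y).1 //; mx_expand.
  mx_lra.
rewrite hSpStE Gp GE -!mulmxA; rewrite -!scalemxAl ?mulmxDl.
move: f1 f2; rewrite -?mulmxA => f1 f2.
tr_expand; rewrite f1 f2; lra.
Qed.

(** The left-hand side is the derivative of the metric in the direction [X],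
    with [Y] and [Z] kept constant: this is what makes the connection metric. *)
Lemma christoffel_metric p X Y Z : SpSt p -> TSpSt p X -> TSpSt p Y ->
  TSpSt p Z ->
  - 2^-1 * (\tr (Y^[*] *m X *m p^[*] *m Z) + \tr (Y^[*] *m p *m X^[*] *m Z)) =
  hSpSt p (christoffel p X Y) Z + hSpSt p Y (christoffel p X Z).
Proof.
move=> Mp TX TY TZ; rewrite [hSpSt p Y _]hSpStC !hSpSt_christoffel //.
have trN (A C : 'M[R]_(k + k)) : C^[*] = - C -> \tr (A^[*] *m C) = - \tr (C *m A).
  by move=> CN; rewrite -mxtrace_splus splusM splusK CN mulNmx linearN.
have TN W : TSpSt p W -> (p^[*] *m W)^[*] = - (p^[*] *m W).
  by move=> /TSpStP TW; rewrite splusM splusK.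
have f1 : \tr (p^[*] *m X *m Z^[*] *m Y) = - \tr (p^[*] *m X *m Y^[*] *m Z).
  rewrite -mulmxA mxtrace_mulC -[Z^[*] *m Y]splusK trN ?TN //.
  by rewrite splusM splusK mulmxA.
have f2 : \tr (p^[*] *m Z *m X^[*] *m Y) = - \tr (Y^[*] *m X *m p^[*] *m Z).
  rewrite -mulmxA mxtrace_mulC -[X^[*] *m Y]splusK trN ?TN // splusM splusK.
  by rewrite mxtrace_mulC mulmxA.
rewrite f1 f2 (TSpStP p Y).1 // !mulNmx mxtraceN; lra.
Qed.

(** The restriction of the metric to a tangent space is nondegenerate: the
    projection is self-adjoint, hence a vector orthogonal to the tangent space
    is orthogonal to all matrices. *)
Lemma hSpSt_nondegenerate p W : SpSt p -> TSpSt p W ->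
  (forall B, hSpSt p W (tangent_proj p B) = 0) -> W = 0.
Proof.
move=> /[dup] Mp /SpStP pp TW h0.
have trN (S : 'M[R]_(k + k)) : S^[*] = S -> \tr (p^[*] *m W *m S) = 0.
  move=> SS; have : \tr (p^[*] *m W *m S) = - \tr (p^[*] *m W *m S).
    rewrite -[in LHS]mxtrace_splus splusM SS splusM splusK (TSpStP p W).1 //.
    by rewrite mulmxN linearN /= mxtrace_mulC.
  by move=> ?; lra.
have trB B : \tr ((W^[*] - 2^-1 *: (W^[*] *m p *m p^[*])) *m B) = 0.
  have := h0 B; rewrite hSpStE /tangent_proj.
  set S := p^[*] *m B + B^[*] *m p.
  have SS : S^[*] = S by rewrite /S; symp_expand; rewrite addrC.
  have := trN S SS; mx_expand.
  rewrite -!(mulmxA _ p^[*] p) pp; mx_expand.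
  rewrite (TSpStP p W).1 //; mx_expand.
  tr_expand; lra.
have W0 : W^[*] - 2^-1 *: (W^[*] *m p *m p^[*]) = 0.
  by apply: mxtrace_mul_eq0.
(* [1 + p p^+] inverts [1 - p p^+ / 2] because [p p^+] is idempotent *)
have : (W^[*] - 2^-1 *: (W^[*] *m p *m p^[*])) *m (1%:M + p *m p^[*]) = W^[*].
  mx_expand; rewrite -!(mulmxA _ p^[*] p) pp; mx_expand; mx_lra.
rewrite W0 mul0mx => W00.
by rewrite -(splusK W) -W00 -[0](scale0r 0) splusZ !scale0r.
Qed.

(** If [DY] is the derivative of a tangent field [Y] in the direction [X], then
    the hypothesis is the derivative of the equation [p^+ Y + Y^+ p = 0]. *)
Lemma christoffel_tangency p X Y DY : SpSt p ->
  X^[*] *m Y + p^[*] *m DY + (DY^[*] *m p + Y^[*] *m X) = 0 ->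
  TSpSt p (DY + christoffel p X Y).
Proof.
move=> /[dup] Mp /SpStP pp DT; apply/TSpStP; rewrite splusD mulmxDl mulmxDr.
have Gp : (christoffel p X Y)^[*] *m p = 2^-1 *: (X^[*] *m Y + Y^[*] *m X).
  have -> : (christoffel p X Y)^[*] *m p = (p^[*] *m christoffel p X Y)^[*].
    by rewrite splusM splusK.
  by rewrite splus_mul_christoffel //; symp_expand; rewrite addrC.
rewrite Gp splus_mul_christoffel //.
apply/eqP; rewrite -subr_eq0 opprK; apply/eqP; rewrite -[RHS]DT; mx_lra.
Qed.

End StiefelAlgebra.

(** * Calculus with the symplectic inverse *)

Section SplusCalculus.
Context {R : realType} {V : normedModType R}.

Lemma is_derive_splus a b (f : V -> 'M[R]_(a + a, b + b)) x v df :
  is_derive x v f df -> is_derive x v (fun y => (f y)^[*]) df^[*].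
Proof.
rewrite splus.unlock => fx.
by apply: is_derive_mulmxr; apply: is_derive_mulmxl; apply: is_derive_trmx.
Qed.

Variables (D : set V) (oD : open D).

Lemma smooth_on_splus a b (f : V -> 'M[R]_(a + a, b + b)) :
  smooth_on D f -> smooth_on D (fun x => (f x)^[*]).
Proof.
move=> fD; rewrite splus.unlock.
apply: smooth_on_mulmx => //; last exact: smooth_on_cst.
apply: smooth_on_mulmx => //; first exact: smooth_on_cst.
exact: smooth_on_trmx.
Qed.

Context {n k : nat}.
Implicit Types p f g : V -> 'M[R]_(n + n, k + k).

Lemma smooth_on_momentum p f : smooth_on D p -> smooth_on D f ->
  smooth_on D (fun x => momentum (p x) (f x)).
Proof.
move=> sp sf; have spp := smooth_on_splus sp; have sfp := smooth_on_splus sf.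
by apply: smooth_onB => //; [apply: smooth_onB => //|];
  do ![apply: smooth_on_mulmx => //].
Qed.

Lemma smooth_on_christoffel p f g :
  smooth_on D p -> smooth_on D f -> smooth_on D g ->
  smooth_on D (fun x => christoffel (p x) (f x) (g x)).
Proof.
move=> sp sf sg; apply: smooth_onZ => //.
by apply: smooth_onD => //; apply: smooth_on_mulmx => //;
  exact: smooth_on_momentum.
Qed.

Lemma smooth_on_tangent_proj p f : smooth_on D p -> smooth_on D f ->
  smooth_on D (fun x => tangent_proj (p x) (f x)).
Proof.
move=> sp sf; have spp := smooth_on_splus sp; have sfp := smooth_on_splus sf.
apply: smooth_onB => //; apply: smooth_onZ => //; apply: smooth_on_mulmx => //.
by apply: smooth_onD => //; apply: smooth_on_mulmx.
Qed.

Lemma is_derive_momentum p f x v dp df : is_derive x v p dp ->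
  is_derive x v f df ->
  is_derive x v (fun y => momentum (p y) (f y))
    (df *m (p x)^[*] + f x *m dp^[*] - (dp *m (f x)^[*] + p x *m df^[*])
     - (((dp *m (p x)^[*] + p x *m dp^[*]) *m f x + p x *m (p x)^[*] *m df)
          *m (p x)^[*] + p x *m (p x)^[*] *m f x *m dp^[*])).
Proof.
move=> hp hf; have hps := is_derive_splus hp; have hfs := is_derive_splus hf.
apply: is_deriveB; last first.
  do 2![apply: is_derive_mulmx => //]; exact: is_derive_mulmx.
by apply: is_deriveB; exact: is_derive_mulmx.
Qed.

End SplusCalculus.

(** * Orbits of one-parameter symplectic groups *)

Section OneParameterOrbit.
Context {R : realType} {n k : nat}.
Variables (W : 'M[R]_(n + n)) (U : 'M[R]_(n + n, k + k)).
Hypothesis Wskew : W^[*] = - W.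

Definition orbit_curve (t : R) : 'M[R]_(n + n, k + k) := expm (t *: W) *m U.

Lemma is_derive_orbit t : is_derive t (1 : R) orbit_curve (W *m orbit_curve t).
Proof.
rewrite /orbit_curve mulmxA; apply: is_derive_mulmxr; exact: is_derive_expm.
Qed.

Lemma orbit_curve0 : orbit_curve 0 = U.
Proof. by rewrite /orbit_curve expm0 mul1mx. Qed.

Lemma smooth_on_orbit : smooth_on setT orbit_curve.
Proof.
apply: smooth_on_mulmx; [exact: openT | exact: smooth_on_expm |].
exact: smooth_on_cst.
Qed.

Lemma expm_symplectic t : (expm (t *: W))^[*] *m expm (t *: W) = 1%:M.
Proof.
rewrite -[RHS](mul1mx 1%:M) -{1}splus1 -!(expm0 W).
apply: (@is_derive0_interval_cst _ _ _ setT
  (fun t => (expm (t *: W))^[*] *m expm (t *: W))) => // s _.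
have dE := is_derive_expm W s.
apply: is_derive_eq (is_derive_mulmx (is_derive_splus dE) dE) _.
by rewrite splusM Wskew mulmxN mulNmx mulmxA addNr.
Qed.

Lemma orbit_curve_SpSt t : SpSt U -> SpSt (orbit_curve t).
Proof.
move=> /SpStP UU; apply/SpStP; rewrite splusM mulmxA.
by rewrite -(mulmxA U^[*]) expm_symplectic mulmx1.
Qed.

End OneParameterOrbit.

(** * The Levi-Civita connection of SpSt *)

Section LeviCivitaSpSt.
Context {R : realType} {n k : nat}.
Local Notation V := 'M[R]_(n + n, k + k).
Local Notation M := (@SpSt R n k).
Local Notation T := (@TSpSt R n k).

(** Differentiating the equation [p^+ Y + Y^+ p = 0] of the tangent spaces
    along a curve in the manifold with velocity [X]. *)
Lemma derive_tangent_field (Y : V -> V) (p X : V) : vector_field M T Y ->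
  M p -> T p X ->
  X^[*] *m Y p + p^[*] *m 'D_X Y p + (('D_X Y p)^[*] *m p + (Y p)^[*] *m X) = 0.
Proof.
move=> [sY tY] Mp TX.
(* a curve in the manifold through [p] with velocity [X] *)
pose W := momentum p X.
have Wskew : W^[*] = - W by exact: momentum_skew.
pose c := orbit_curve W p.
have c0 : c 0 = p by exact: orbit_curve0.
have dc : is_derive (0 : R) (1 : R) c X.
  apply: is_derive_eq (is_derive_orbit W p 0) _.
  by rewrite orbit_curve0 momentum_apply.
have dcs := is_derive_splus dc.
have dY : is_derive (0 : R) (1 : R) (Y \o c) ('D_X Y p).
  have dYc : differentiable Y (c 0) by apply: smooth_on_differentiable sY.
  have dcc : differentiable c 0 by apply/derivable1_diffP; case: dc.
  have := is_derive_comp_curve dYc dcc; rewrite derive1E c0.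
  by have -> : 'D_1 c 0 = X by case: dc.
have dYs := is_derive_splus dY.
have := is_deriveD (is_derive_mulmx dcs dY) (is_derive_mulmx dYs dc).
rewrite (_ : _ + _ = cst 0); last first.
  apply/funext => t; rewrite -[LHS]/((c t)^[*] *m Y (c t) + (Y (c t))^[*] *m c t).
  have /TSpStP -> := tY (c t) (orbit_curve_SpSt Wskew t Mp).
  by rewrite addrN.
by move=> [_]; rewrite derive_cst /= c0.
Qed.

Definition nabla_SpSt (X Y : V -> V) (p : V) : V :=
  'D_(X p) Y p + christoffel p (X p) (Y p).

Lemma levi_civita_SpSt : levi_civita M T (@hSpSt R n k) nabla_SpSt.
Proof.
have diffY Y p : vector_field M T Y -> differentiable Y p.
  by move=> [sY _]; apply: smooth_on_differentiable sY.
have isd Y p v : vector_field M T Y -> is_derive p v Y ('D_v Y p).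
  by move=> hY; apply: derivableP; apply: diff_derivable; exact: diffY.
split.
- move=> X Y hX hY; split=> [|p Mp].
    apply: smooth_onD; first exact: openT.
      by apply: smooth_on_derive_along; [exact: openT | case: hX | case: hY].
    apply: smooth_on_christoffel; [exact: openT | exact: smooth_on_id | |].
      by case: hX.
    by case: hY.
  apply: christoffel_tangency => //; apply: derive_tangent_field => //.
  exact: hX.2.
- move=> X1 X2 Y hX1 hX2 hY p Mp; rewrite /nabla_SpSt /=.
  have dY := diffY _ p hY.
  by rewrite !deriveE // linearD christoffelDl addrACA.
- move=> f X Y sf hX hY p Mp; rewrite /nabla_SpSt.
  have dY := diffY _ p hY.
  by rewrite !deriveE // linearZ christoffelZl scalerDr.
- move=> X Y1 Y2 hX hY1 hY2 p Mp; rewrite /nabla_SpSt /=.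
  have d := is_deriveD (isd _ p (X p) hY1) (isd _ p (X p) hY2).
  rewrite -[Y1 \+ Y2]/(Y1 + Y2) (derive_val (is_derive:=d)).
  by rewrite christoffelDr addrACA.
- move=> f X Y sf hX hY p Mp; rewrite /nabla_SpSt /=.
  have df : is_derive p (X p) f ('D_(X p) f p).
    apply: derivableP; apply: diff_derivable.
    exact: smooth_on_differentiable sf.
  have d := is_derive_scalemx df (isd _ p (X p) hY).
  rewrite (derive_val (is_derive:=d)).
  by rewrite christoffelZr scalerDr addrA.
- move=> X Y hX hY p Mp; rewrite /nabla_SpSt (christoffelC p (Y p)).
  by rewrite opprD addrACA addrN addr0.
- move=> X Y Z hX hY hZ p Mp; rewrite /nabla_SpSt.
  under eq_fun do rewrite hSpStE.
  have dX := is_derive_id p (X p); have dXs := is_derive_splus dX.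
  have dY := isd _ p (X p) hY; have dYs := is_derive_splus dY.
  have dZ := isd _ p (X p) hZ.
  have d1 := is_derive_mxtrace (is_derive_mulmx dYs dZ).
  have d2 := is_derive_mxtrace (is_derive_mulmx (is_derive_mulmx
    (is_derive_mulmx dYs dX) dXs) dZ).
  have d := is_deriveB d1 (is_deriveZ (2^-1 : R) d2).
  apply: (etrans (@derive_val _ _ _ _ _ _ _ d)).
  have := christoffel_metric Mp (hX.2 p Mp) (hY.2 p Mp) (hZ.2 p Mp).
  rewrite !hSpStDl [hSpSt p (Y p) (_ + _)]hSpStC hSpStDl.
  rewrite ![hSpSt p _ (Y p)]hSpStC [hSpSt p _ ('D_(X p) Z p)]hSpStE.
  rewrite [hSpSt p ('D_(X p) Y p) _]hSpStE => E.
  rewrite addrACA -E; mx_expand; tr_expand.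
  rewrite /GRing.scale /=; lra.
Qed.

End LeviCivitaSpSt.

(** * Geodesics of SpSt *)

Section GeodesicsSpSt.
Context {R : realType} {n k : nat}.
Local Notation V := 'M[R]_(n + n, k + k).
Local Notation M := (@SpSt R n k).
Local Notation T := (@TSpSt R n k).

Section CurveInSpSt.
Variables (I : set R) (c : R -> V).
Hypotheses (oI : open I) (sc : smooth_on I c) (cM : forall t, I t -> M (c t)).

Let near_I t : I t -> \near t, I t.
Proof. by move=> It; exact: open_nbhs_nbhs. Qed.

Lemma is_derive_smooth (W : normedModType R) (f : R -> W) t :
  smooth_on I f -> I t -> is_derive t (1 : R) f ('D_1 f t).
Proof.
move=> sf It; apply: derivableP; apply: diff_derivable.
exact: smooth_on_differentiable sf.
Qed.

Lemma is_derive_curve t : I t -> is_derive t (1 : R) c (c^`()%classic t).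
Proof. by move=> It; rewrite derive1E; exact: is_derive_smooth. Qed.

Lemma smooth_on_velocity : smooth_on I c^`()%classic.
Proof.
have -> : c^`()%classic = 'D_1 c by apply/funext => t; rewrite derive1E.
exact: smooth_on_derive.
Qed.

Lemma velocity_tangent t : I t -> T (c t) (c^`()%classic t).
Proof.
move=> It; have dc := is_derive_curve It.
have [_] := is_derive_mulmx (is_derive_splus dc) dc.
rewrite (@near_eq_derive _ _ _ _ (cst 1%:M)) ?derive_cst.
  by move=> /esym/eqP; rewrite addr_eq0 => /eqP ?; apply/TSpStP.
by near=> s; apply/SpStP/cM; near: s; exact: near_I.
Unshelve. all: by end_near. Qed.

Lemma derive_field_along Z t : field_along T I c Z -> I t ->
  (c^`()%classic t)^[*] *m Z t + (c t)^[*] *m 'D_1 Z t +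
  (('D_1 Z t)^[*] *m c t + (Z t)^[*] *m c^`()%classic t) = 0.
Proof.
move=> [sZ tZ] It; have dc := is_derive_curve It.
have dZ := is_derive_smooth sZ It.
have := is_deriveD (is_derive_mulmx (is_derive_splus dc) dZ)
  (is_derive_mulmx (is_derive_splus dZ) dc).
move=> [_ <-]; rewrite (@near_eq_derive _ _ _ _ (cst 0)) ?derive_cst //.
near=> s; have Is : I s by near: s; exact: near_I.
rewrite -[LHS]/((c s)^[*] *m Z s + (Z s)^[*] *m c s).
by have /TSpStP -> := tZ s Is; rewrite addrN.
Unshelve. all: by end_near. Qed.

Definition covariant_derivative_SpSt (Z : R -> V) (t : R) : V :=
  'D_1 Z t + christoffel (c t) (c^`()%classic t) (Z t).

Lemma covariant_derivative_SpStP :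
  covariant_derivative_along M T nabla_SpSt I c covariant_derivative_SpSt.
Proof.
split.
- move=> Z hZ; have [sZ tZ] := hZ; split=> [|t It].
    apply: smooth_onD => //; first exact: smooth_on_derive.
    apply: smooth_on_christoffel => //; exact: smooth_on_velocity.
  by apply: christoffel_tangency; [exact: cM | exact: derive_field_along].
- move=> Z1 Z2 [s1 _] [s2 _] t It; rewrite /covariant_derivative_SpSt.
  have d := is_deriveD (is_derive_smooth s1 It) (is_derive_smooth s2 It).
  have -> : 'D_1 (Z1 \+ Z2) t = 'D_1 Z1 t + 'D_1 Z2 t.
    exact: (@derive_val _ _ _ _ _ _ _ d).
  by rewrite christoffelDr addrACA.
- move=> f Z sf [sZ _] t It; rewrite /covariant_derivative_SpSt (derive1E f).
  have d := is_derive_scalemx (is_derive_smooth sf It) (is_derive_smooth sZ It).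
  by rewrite (@derive_val _ _ _ _ _ _ _ d) christoffelZr scalerDr addrA.
- move=> X Y hX hY t It Xc; rewrite /covariant_derivative_SpSt /nabla_SpSt Xc.
  have dY : differentiable Y (c t) by apply: smooth_on_differentiable hY.1.
  have dc := smooth_on_differentiable It sc.
  by rewrite (@derive_val _ _ _ _ _ _ _ (is_derive_comp_curve dY dc)).
Qed.

End CurveInSpSt.

Lemma orbit_curve_velocity (W : 'M[R]_(n + n)) (U : V) :
  (orbit_curve W U)^`()%classic = fun t => W *m orbit_curve W U t.
Proof.
apply/funext => t; rewrite derive1E.
exact: (@derive_val _ _ _ _ _ _ _ (is_derive_orbit W U t)).
Qed.

(** By equivariance the momentum of the orbit is the constant [W], so the
    Christoffel form of the velocity is [- W (W c)], the opposite of
    the acceleration. *)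
Lemma geodesic_orbit (U X : V) : M U -> T U X ->
  geodesic M T (@hSpSt R n k) setT (orbit_curve (momentum U X) U).
Proof.
move=> MU TX; set W := momentum U X; set c := orbit_curve W U.
have Wskew : W^[*] = - W by exact: momentum_skew.
have cM t : [set: R] t -> M (c t) by move=> _; exact: orbit_curve_SpSt.
have sc : smooth_on setT c by exact: smooth_on_orbit.
split=> //; first exact: openT.
exists nabla_SpSt, (covariant_derivative_SpSt c); split.
- exact: levi_civita_SpSt.
- by apply: covariant_derivative_SpStP => //; exact: openT.
move=> t _; rewrite /covariant_derivative_SpSt orbit_curve_velocity.
have Wc : momentum (c t) (W *m c t) = W.
  have -> : W *m c t = expm (t *: W) *m X.
    by rewrite mulmxA -expm_mulmxC -mulmxA momentum_apply.
  rewrite momentum_equivariant; last exact: expm_symplectic.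
  rewrite -/W expm_mulmxC -mulmxA (mulmx1C (expm_symplectic Wskew t)).
  exact: mulmx1.
have dc := is_derive_mulmxl W (is_derive_orbit W U t).
rewrite (@derive_val _ _ _ _ _ _ _ dc) /christoffel Wc; mx_lra.
Qed.

Lemma vector_field_tangent_proj (B : V) :
  vector_field M T (fun p => tangent_proj p B).
Proof.
split=> [|p Mp]; last exact: tangent_projT.
apply: smooth_on_tangent_proj; first exact: openT.
  exact: smooth_on_id.
exact: smooth_on_cst.
Qed.

Lemma levi_civita_SpSt_unique nabla : levi_civita M T (@hSpSt R n k) nabla ->
  forall X Y, vector_field M T X -> vector_field M T Y ->
  forall p, M p -> nabla X Y p = nabla_SpSt X Y p.
Proof.
move=> lc X Y hX hY p Mp; apply/eqP; rewrite -subr_eq0; apply/eqP.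
apply: (hSpSt_nondegenerate Mp) => [|B].
  apply: TSpStD; first exact: (lc_field lc hX hY).2.
  rewrite -scaleN1r; apply: TSpStZ.
  exact: (lc_field levi_civita_SpSt hX hY).2.
apply: (levi_civita_unique _ _ lc levi_civita_SpSt hX hY
  (vector_field_tangent_proj B) Mp) => *; [exact: hSpStBl | exact: hSpStC].
Qed.

(** The left-hand side is the derivative of [momentum c c'] along a curve [c]
    through [p] with velocity [X] and acceleration [momentum p X *m X]. *)
Lemma momentum_conserved p X : M p -> T p X ->
  let A := momentum p X *m X in
  A *m p^[*] + X *m X^[*] - (X *m X^[*] + p *m A^[*])
  - (((X *m p^[*] + p *m X^[*]) *m X + p *m p^[*] *m A) *m p^[*]
     + p *m p^[*] *m X *m X^[*]) = 0.
Proof.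
move=> /SpStP pp TX /=; rewrite momentum_mul; symp_expand.
rewrite (TSpStP p X).1 //; mx_expand.
rewrite -!(mulmxA _ p^[*] p) pp; mx_expand; mx_lra.
Qed.

(** The geodesic equation is [c'' = W(c') c'], and it makes the momentum [W(c')]
    constant; since [c' = W(c') c], the curve [c] then solves a linear
    differential equation with constant coefficients. *)
Lemma geodesic_eq_orbit (I : set R) (c : R -> V) :
  geodesic M T (@hSpSt R n k) I c -> I 0 -> forall t, I t ->
  c t = orbit_curve (momentum (c 0) (c^`()%classic 0)) (c 0) t.
Proof.
move=> [oI itvI sc cM [nabla [D [lc covD Dc0]]]] I0.
have tc := velocity_tangent oI sc cM.
have sv := smooth_on_velocity sc.
have accel t : I t -> 'D_1 c^`()%classic t =
    momentum (c t) (c^`()%classic t) *m c^`()%classic t.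
  move=> It; have := Dc0 t It.
  rewrite (@covariant_derivative_formula _ _ _ M T nabla I c D oI cM covD
    _ _ _ (@tangent_proj R n k) _ _ _ _ (@christoffel R n k)) //.
  - by move=> /eqP; rewrite addr_eq0 => /eqP ->; rewrite /christoffel; mx_lra.
  - by move=> p _; exact: TSpSt0.
  - by move=> p u v _; exact: TSpStD.
  - by move=> p x u _; exact: TSpStZ.
  - exact: vector_field_tangent_proj.
  - by move=> p v _; exact: tangent_proj_id.
  - exact: tangent_proj_linear.
  - by move=> v; apply: smooth_on_tangent_proj => //; exact: smooth_on_cst.
  - exact: christoffel_linear.
  - exact: levi_civita_SpSt_unique.
pose K s := momentum (c s) (c^`()%classic s).
have dK s : I s -> is_derive s (1 : R) K 0.
  move=> Is; have dc := is_derive_curve sc Is.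
  have dv := is_derive_smooth sv Is; rewrite accel // in dv.
  apply: is_derive_eq (is_derive_momentum dc dv) _.
  exact: momentum_conserved (cM _ Is) (tc _ Is).
have cE s : I s -> is_derive s (1 : R) c (K 0 *m c s).
  move=> Is; apply: is_derive_eq (is_derive_curve sc Is) _.
  rewrite (is_derive0_interval_cst itvI dK I0 Is) /K momentum_apply //.
    exact: cM.
  exact: tc.
by move=> t It; exact: (linear_ode_interval itvI I0 cE It).
Qed.

(** The orbit is a geodesic defined on the whole line, and [geodesic_eq_orbit]
    shows that any other candidate takes the same value at time 1. *)
Lemma ExpSpStE (U X : V) : M U -> T U X ->
  ExpSpSt U X = orbit_curve (momentum U X) U 1.
Proof.
move=> MU TX; apply: get_unique => [|q].
  exists setT, (orbit_curve (momentum U X) U); split=> //.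
    exact: geodesic_orbit.
  split=> //; first exact: orbit_curve0.
  by rewrite orbit_curve_velocity orbit_curve0 momentum_apply.
by move=> [I [c [gc I0 I1 [c0 v0 <-]]]]; rewrite (geodesic_eq_orbit gc) // c0 v0.
Qed.

(** Since [U^+ H = 0], the matrix [W = momentum U X] satisfies
    [W U = U A + H] and [W H = - U (H^+ H)]; the block matrix is that of [W] after the change of basis
    from [U, H] to [U, U A / 2 + H]. *)
Lemma momentum_block (U X : V) : M U -> T U X ->
  let A := U^[*] *m X in
  let H := X - U *m A in
  momentum U X *m row_mx U (2^-1 *: (U *m A) + H) =
  row_mx U (2^-1 *: (U *m A) + H) *m
    block_mx (2^-1 *: A) (4^-1 *: (A *m A) - H^[*] *m H) 1%:M (2^-1 *: A).
Proof.
move=> MU TX A H; have /SpStP UU := MU.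
have UH : U^[*] *m H = 0 by rewrite mulmxBr mulmxA UU mul1mx subrr.
have XE : X = U *m A + H by rewrite addrC subrK.
have XH : X^[*] *m H = H^[*] *m H.
  by rewrite [in X in X *m _]XE splusD splusM mulmxDl -mulmxA UH mulmx0 add0r.
clearbody H; clearbody A.
rewrite mul_mx_row mul_row_block mulmxDr -scalemxAr mulmxA momentum_apply //.
rewrite [momentum U X *m H]momentum_mul UH XH.
congr row_mx; first by rewrite {1}XE; mx_expand; mx_lra.
rewrite {1}XE; mx_expand; mx_lra.
Qed.

End GeodesicsSpSt.

Theorem proposition3p8 (R : realType) (n k : nat) (hk : (0 < k)%N)
    (hkn : (k <= n)%N) (U Delta : 'M[R]_(n + n, k + k))
    (hU : SpSt U) (hDelta : TSpSt U Delta) :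
  let A : 'M[R]_(k + k) := U^[+] *m Delta in
  let H : 'M[R]_(n + n, k + k) := Delta - U *m A in
  let c : R -> 'M[R]_(n + n, k + k) := fun t =>
    row_mx U (2^-1 *: (U *m A) + H)
    *m expm (t *: block_mx (2^-1 *: A) (4^-1 *: (A *m A) - H^[+] *m H)
                           1%:M        (2^-1 *: A))
    *m col_mx 1%:M 0 in
  H^[+] *m H \in unitmx ->
  [/\ geodesic (@SpSt R n k) (@TSpSt R n k) (@hSpSt R n k) setT c,
      c 0 = U, c^`() 0 = Delta &
      forall t : R, ExpSpSt U (t *: Delta) = c t].
Proof.
move=> A H c _.
set W := momentum U Delta.
have cE : c = orbit_curve W U.
  apply/funext => t.
  have c0 : c 0 = U.
    by rewrite /c expm0 mulmx1 mul_row_col mulmx1 mulmx0 addr0.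
  rewrite -[in RHS]c0 /orbit_curve.
  apply: (@linear_ode_interval _ _ _ W setT) => // s _.
  pose Q := row_mx U (2^-1 *: (U *m A) + H).
  pose B := block_mx (2^-1 *: A) (4^-1 *: (A *m A) - H^[+] *m H)
                     1%:M (2^-1 *: A).
  have WQ : W *m Q = Q *m B.
    by have := momentum_block hU hDelta; rewrite /= !splusE.

  rewrite -[c]/(fun t => Q *m expm (t *: B) *m col_mx 1%:M 0).
  rewrite !mulmxA WQ -(mulmxA Q).
  by apply: is_derive_mulmxr; apply: is_derive_mulmxl; exact: is_derive_expm.
rewrite cE; split.
- exact: geodesic_orbit.
- exact: orbit_curve0.
- by rewrite orbit_curve_velocity orbit_curve0 momentum_apply.
move=> t; rewrite (ExpSpStE hU (TSpStZ t hDelta)).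
rewrite /orbit_curve scale1r (_ : momentum U (t *: Delta) = t *: W) //.
by rewrite /W /momentum; symp_expand; mx_expand; mx_lra.
Qed.
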